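(* Let $X$ be an $\mathbb R^d$-valued compound Poisson process on $[0,1)$ with intensity $\lambda>0$ and jump distribution that of $Z^{(1)}$ (with $\mathbb P(Z^{(1)}=0)=0$), let $s>0$, and assume that the distribution of $Z^{(1)}$ has a nonzero absolutely continuous component (with respect to Lebesgue measure on $\mathbb R^d$). Then $$-\log D^{(q)}(r\,|\,X,\rho_{\mathbf D},s)\lesssim\sqrt{\frac{2}{s(1+d)}\,r\log r}\quad(r\to\infty).$$ If additionally $\limsup_{\varepsilon\to0}\frac{\log d^{(q)}(\varepsilon\,|\,Z^{(1)},\|\cdot\|_\infty,s)}{\log(1/\varepsilon)}=d$, then $-\log D^{(q)}(r\,|\,X,\rho_{\mathbf D},s)\sim\sqrt{\frac{2}{s(1+d)}r\log r}$.
   Context: Compound Poisson process: $(e_j)$ i.i.d. standard exponential, $N(t)=\max\{n\ge0:\sum_{j\le n}e_j\le\lambda t\}$, $(Z^{(i)})$ i.i.d. $\mathbb R^d$-valued independent of $(e_j)$ with $\mathbb P(Z^{(1)}=0)=0$, $X(t)=\sum_{i=1}^{N(t)}Z^{(i)}$, $t\in[0,1)$. Distortion on paths: $\rho_{\mathbf D}(f,g)=\int_0^1\|f(t)-g(t)\|_\infty dt$. $D^{(q)}(r\,|\,V,\rho,s)=\inf\{(\mathbb E\min_{a\in\mathcal C}\rho(V,a)^s)^{1/s}:\log\#\mathcal C\le r\}$ (natural log); $d^{(q)}(\varepsilon\,|\,V,\rho,s)=\inf\{n\ge1:D^{(q)}(\log n\,|\,V,\rho,s)\le\varepsilon\}$,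 with $\rho(x,y)=\|x-y\|_\infty$. $f\lesssim g$: $\limsup f/g\le1$; $f\sim g$: $\lim f/g=1$. *)

(* Defs.v *)
From HB Require Import structures.
From mathcomp Require Import all_boot all_order all_algebra.
From mathcomp Require Import all_classical all_reals all_analysis.
Set Implicit Arguments. Unset Strict Implicit. Unset Printing Implicit Defensive.
Import Order.TTheory GRing.Theory Num.Theory.
Import numFieldNormedType.Exports.
Local Open Scope classical_set_scope.
Local Open Scope ring_scope.

Section defs.
Context {R : realType}.

(* R^d is represented by d.-tuple R, with its product (Borel) sigma-algebra. *)

Definition supdist (d : nat) (x y : d.-tuple R) : R :=
  \big[Num.max/0]_(i < d) `|tnth x i - tnth y i|.

Definition rhoD (d : nat) (f g : R -> d.-tuple R) : \bar R :=
  (\int[lebesgue_measure]_(t in `[0%R, 1%R[) (supdist (f t) (g t))%:E)%E.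

(* Iterated d-fold Lebesgue integral on R^d (= integral w.r.t. Lebesgue
   measure lambda^d for nonnegative Borel integrands, by Tonelli). *)
Fixpoint lebT (n : nat) : (n.-tuple R -> \bar R) -> \bar R :=
  match n with
  | 0 => fun f => f [tuple]
  | n'.+1 => fun f =>
      (\int[lebesgue_measure]_x lebT (fun t : n'.-tuple R => f (cons_tuple x t)))%E
  end.

Definition lebesgue_d (n : nat) (A : set (n.-tuple R)) : \bar R :=
  lebT (fun x => (\1_A x)%:E).

(* Quantization error D^(q)(r | V, rho, s): infimum over codebooks
   C = {C_0,...,C_(n-1)} (elements taken in the admissible set Adm) with
   log #C <= r (natural log) of (E min_{a in C} rho(V,a)^s)^(1/s). *)
Definition Dq {dT} {T : measurableType dT} (P : probability T R) {U : Type}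
    (V : T -> U) (rho : U -> U -> \bar R) (Adm : set U) (s r : R) : \bar R :=
  ereal_inf [set (poweR (\int[P]_w
                    (\big[Order.min/+oo%E]_(i < projT1 nC)
                        poweR (rho (V w) (projT2 nC i)) s)) s^-1)%E
            | nC in [set nC : {n : nat & 'I_n -> U} |
                     (1 <= projT1 nC)%N /\ (forall i, Adm (projT2 nC i)) /\
                     ln (projT1 nC)%:R <= r]].

(* N(t) = max{n >= 0 : e_1 + ... + e_n <= u}  (u = lambda t); the e's are
   indexed from 0 here: e_1, e_2, ... are e 0, e 1, ...  (0 if no max exists,
   a null event) *)
Definition Npois (e : nat -> R) (u : R) : nat :=
  xget 0%N [set n : nat | \sum_(j < n) e j <= u /\
                          (forall m : nat, \sum_(j < m) e j <= u -> (m <= n)%N)].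

(* compound Poisson path X(t) = sum_{i=1}^{N(t)} Z^(i)  (Z^(i) is Z (i-1)) *)
Definition Xcp (d : nat) {T : Type} (lam : R) (e : nat -> T -> R)
    (Z : nat -> T -> d.-tuple R) (w : T) (t : R) : d.-tuple R :=
  [tuple \sum_(i < Npois (fun j => e j w) (lam * t)) tnth (Z i w) k | k < d].

Definition indep_eZ (d : nat) {dT} {T : measurableType dT} (P : probability T R)
    (e : nat -> T -> R) (Z : nat -> T -> d.-tuple R) : Prop :=
  forall (J K : seq nat) (A : nat -> set R) (B : nat -> set (d.-tuple R)),
    uniq J -> uniq K ->
    (forall j, measurable (A j)) -> (forall k, measurable (B k)) ->
    P (\bigcap_(j in [set` J]) (e j @^-1` A j) `&`
       \bigcap_(k in [set` K]) (Z k @^-1` B k)) =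
    (\prod_(j <- J) P (e j @^-1` A j) * \prod_(k <- K) P (Z k @^-1` B k))%E.

(* d^(q)(eps | V, ||.||_oo, s) = inf{n >= 1 : D^(q)(log n | V, ||.||_oo, s) <= eps}
   (+oo if the set is empty); codebooks are arbitrary points of R^d. *)
Definition dq (d : nat) {dT} {T : measurableType dT} (P : probability T R)
    (V : T -> d.-tuple R) (s eps : R) : \bar R :=
  ereal_inf [set (n%:R)%:E | n in [set n : nat |
     (1 <= n)%N /\ (Dq P V (fun x y => (supdist x y)%:E) setT s (ln n%:R) <= eps%:E)%E]].

Definition path_adm (d : nat) : set (R -> d.-tuple R) :=
  [set g : R -> d.-tuple R | measurable_fun (`[0%R, 1%R[ : set R) g].

End defs.

(* Main.v *)
Require Import Defs.
From HB Require Import structures.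
From mathcomp Require Import all_boot all_order all_algebra.
From mathcomp Require Import all_classical all_reals all_analysis.
From mathcomp Require Import measurable_realfun.
From mathcomp Require Import zify lra ring.
Set Implicit Arguments. Unset Strict Implicit. Unset Printing Implicit Defensive.
Import Order.TTheory GRing.Theory Num.Theory.
Import numFieldNormedType.Exports.
Local Open Scope classical_set_scope.
Local Open Scope ring_scope.

(** A path with [n] jumps carries [n (1 + d)] real parameters, so [exp r] codewords
    resolve it up to [exp (- r / (n (1 + d)))], while [n] jumps have probability
    [exp (- n ln n (1 + o(1)))]. The error to the power [s] is thus governed by the
    minimum over [n] of [s r / (n (1 + d)) + n ln n], attained for [n] close to
    [sqrt (2 s r / ((1 + d) ln r))].

    For the lower bound on the error one such [n] suffices: on the event that the first
    [n] gaps are of order [1 / n] and the jumps lie in a set where the jump law is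
    nearly bounded by Lebesgue measure, two paths close to the same codeword have
    close gaps and jumps, which bounds the probability of a small ball by that of a
    product of boxes. For the upper bound, each [m <= sqrt r] gets its own codebook of
    paths with [m] jumps, with times on a grid and jumps from a codebook of the jump
    law, and more than [sqrt r] jumps are coded by the zero path. *)

(** * Path distance *)

(** At the optimal [n], where [ln n] is close to [ln r / 2], the terms [s r / (n (1 + d))] and
    [n ln n] are equal to leading order, each half of [sqrt (2 s r ln r / (1 + d))]; the power
    [1 / s] then gives the stated constant. Since this [n] is small compared with [sqrt (r ln r)],
    factors [C ^ n] do not affect the rate, which permits crude estimates such as [(4 lam / m) ^ m]
    for the probability of [m] jumps. Three obstacles shape the argument. The absolutely continuous
    component comes without a density, so a set on which the jump law is controlled at all scales is
    extracted from dyadic cubes, at the price of a weight quadratic in the level. Codewords are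
    arbitrary measurable paths with no jumps to compare with, so two sample paths near the same
    codeword are compared with each other. Finally, the cost of a jump is integrated over an event
    that fixes how many jumps occur, so the Poisson tail is estimated jointly with an event for one
    jump. *)

(* The integral of a nonnegative function is a supremum over the simple functions
   below it, so it is monotone even on non-measurable integrands. *)
Lemma le_integral_subset {d} {T : measurableType d} {R : realType}
    (mu : {measure set T -> \bar R}) (D E : set T) (f g : T -> \bar R) :
  D `<=` E -> (forall x, D x -> 0 <= f x)%E -> (forall x, E x -> 0 <= g x)%E ->
  (forall x, D x -> f x <= g x)%E ->
  (\int[mu]_(x in D) f x <= \int[mu]_(x in E) g x)%E.
Proof.
move=> DE f0 g0 fg; rewrite !ge0_integralE//.
apply: le_ereal_sup => _ [h /= hf <-]; exists h => //= x.
apply: (le_trans (hf x)); rewrite !patchE.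
case: ifPn => [|_]; last by case: ifPn => //; rewrite inE => /g0.
rewrite inE => Dx; have Ex := DE _ Dx.
by rewrite (mem_set Ex); exact: fg.
Qed.

Section supdist.
Context {R : realType} {d : nat}.
Implicit Types x y z : d.-tuple R.

Lemma supdist_ge0 x y : 0 <= supdist x y.
Proof. exact: bigmax_ge_id. Qed.

Lemma ler_tnth_supdist x y i : `|tnth x i - tnth y i| <= supdist x y.
Proof. exact: (le_bigmax_cond _ (fun i => `|tnth x i - tnth y i|)). Qed.

Lemma supdist_le x y b : 0 <= b ->
  (forall i, `|tnth x i - tnth y i| <= b) -> supdist x y <= b.
Proof. by move=> b0 h; apply: bigmax_le. Qed.

Lemma supdistC x y : supdist x y = supdist y x.
Proof. by apply: eq_bigr => i _; rewrite distrC. Qed.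

Lemma supdist_triangle y x z : supdist x z <= supdist x y + supdist y z.
Proof.
apply: supdist_le => [|i]; first by rewrite addr_ge0 ?supdist_ge0.
apply: (le_trans (ler_distD (tnth y i) _ _)).
by rewrite lerD ?ler_tnth_supdist.
Qed.

Lemma measurable_supdistr y : measurable_fun setT (fun x => supdist x y).
Proof.
rewrite /supdist; elim: (index_enum 'I_d) => [|i l ih].
  by under eq_fun do rewrite big_nil; exact: measurable_cst.
under eq_fun do rewrite big_cons; apply: measurable_maxr => //.
apply: measurableT_comp => //; apply: measurable_funB => //.
exact: measurable_tnth.
Qed.

End supdist.

Section rhoD.
Context {R : realType} {d : nat}.
Implicit Types f g : R -> d.-tuple R.

Lemma rhoD_ge0 f g : (0 <= rhoD f g)%E.
Proof. by apply: integral_ge0 => t _; rewrite lee_fin supdist_ge0. Qed.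

(** Integrate over [[a, b[] the triangle inequality through [g t]: each of the two terms has
    integral at most [eps]. Measurability of [g] enters when the integral of the sum is split. *)
Lemma rhoD_common_constancy (f1 f2 g : R -> d.-tuple R) (u v : d.-tuple R)
    (a b eps : R) :
  path_adm g -> 0 <= a -> a <= b -> b <= 1 ->
  (forall t, a <= t < b -> f1 t = u) -> (forall t, a <= t < b -> f2 t = v) ->
  (rhoD f1 g <= eps%:E)%E -> (rhoD f2 g <= eps%:E)%E ->
  (b - a) * supdist u v <= 2 * eps.
Proof.
move=> mg a0 ab b1 f1u f2v h1 h2.
have sub : `[a, b[%classic `<=` (`[0%R, 1%R[ : set R).
  move=> t /=; rewrite !in_itv/= => /andP[at' tb].
  by rewrite (le_trans a0 at') (lt_le_trans tb b1).
have mg' w : measurable_fun `[a, b[ (fun t => (supdist w (g t))%:E).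
  apply/measurable_EFinP.
  rewrite (_ : (fun t => _) = (fun y => supdist y w) \o g); last first.
    by apply/funext => t /=; rewrite supdistC.
  apply: (measurableT_comp (measurable_supdistr w)).
  by apply: measurable_funS mg.
have key f w : (forall t, a <= t < b -> f t = w) -> (rhoD f g <= eps%:E)%E ->
    (\int[lebesgue_measure]_(t in `[a, b[) (supdist w (g t))%:E <= eps%:E)%E.
  move=> fw; apply: le_trans; apply: le_integral_subset => //.
  - by move=> t _; rewrite lee_fin supdist_ge0.
  - by move=> t _; rewrite lee_fin supdist_ge0.
  - by move=> t /=; rewrite in_itv/= => tab; rewrite fw.
rewrite -lee_fin.
apply: (@le_trans _ _ (\int[lebesgue_measure]_(t in `[a, b[)
    ((supdist u (g t))%:E + (supdist v (g t))%:E))%E).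
  rewrite mulrC EFinM.
  rewrite (_ : (b - a)%:E = lebesgue_measure (`[a, b[%classic : set R)).
    rewrite -integral_cst//; apply: le_integral_subset => //.
    - by move=> t _; rewrite lee_fin supdist_ge0.
    - by move=> t _; rewrite adde_ge0// lee_fin supdist_ge0.
    - move=> t _; rewrite -EFinD lee_fin [X in _ + X]supdistC.
      exact: supdist_triangle.
  rewrite lebesgue_measure_itv/= lte_fin -EFinB.
  by case: ltP => // ba; rewrite (le_anti (introT andP (conj ab ba))) subrr.
rewrite ge0_integralD//=.
- by rewrite mulr_natl mulr2n EFinD; apply: leeD; [exact: (key f1)|exact: (key f2)].
- by move=> t _; rewrite lee_fin supdist_ge0.
- exact: mg'.
- by move=> t _; rewrite lee_fin supdist_ge0.
- exact: mg'.
Qed.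

End rhoD.

(** * Jump times, and their recovery from a nearby codeword *)

Section Npois.
Context {R : realType} (e : nat -> R).
Hypothesis e0 : forall j, 0 <= e j.

Lemma arrival_nondecreasing (i j : nat) : (i <= j)%N ->
  \sum_(k < i) e k <= \sum_(k < j) e k.
Proof.
move=> ij; rewrite -(subnKC ij); elim: (j - i)%N => [|m ih]; first by rewrite addn0.
by rewrite addnS big_ord_recr/= (le_trans ih)// lerDl.
Qed.

Lemma NpoisE (u : R) (i : nat) :
  \sum_(k < i) e k <= u -> u < \sum_(k < i.+1) e k -> Npois e u = i.
Proof.
move=> h1 h2; rewrite /Npois.
have maxi m : \sum_(k < m) e k <= u -> (m <= i)%N.
  move=> hm; rewrite leqNgt; apply/negP => /arrival_nondecreasing h3.
  by have := lt_le_trans h2 (le_trans h3 hm); rewrite ltxx.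
case: xgetP => [n -> [n1 n2]|/(_ i)[]]; last by split.
by apply/eqP; rewrite eqn_leq maxi//= n2.
Qed.

End Npois.

(** Converts a shift that is small on the scale [eps / eta] into a fraction of the minimal gap [dl];
    [16 * eps <= dl * eta] is the standing smallness condition below. *)
Lemma le_quarter {R : realFieldType} (x dl eta eps : R) :
  0 < eta -> 16 * eps <= dl * eta -> x * eta <= 4 * eps -> x <= dl / 4.
Proof. by move=> eta0 h1 h2; rewrite -(ler_pM2r eta0); lra. Qed.

Lemma dist_le_bounds {R : realFieldType} (x y b : R) :
  `|x - y| <= b -> y <= x + b /\ x <= y + b.
Proof. by rewrite ler_norml => /andP[h1 h2]; split; lra. Qed.

Section separation.
Context {R : realType} {d : nat} {T : Type}.
Variables (lam : R) (e : nat -> T -> R) (Z : nat -> T -> d.-tuple R).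
Hypothesis lam0 : 0 < lam.

Definition jump_time (i : nat) (w : T) : R := (\sum_(k < i) e k w) / lam.

Definition jump_sum (i : nat) (w : T) : d.-tuple R :=
  [tuple \sum_(k < i) tnth (Z k w) l | l < d].

Lemma jump_timeS i w : jump_time i.+1 w = jump_time i w + e i w / lam.
Proof. by rewrite /jump_time big_ord_recr/= mulrDl. Qed.

Lemma jump_time0 w : jump_time 0 w = 0.
Proof. by rewrite /jump_time big_ord0 mul0r. Qed.

Lemma jump_time_nondecreasing w i j : (forall k, 0 <= e k w) -> (i <= j)%N ->
  jump_time i w <= jump_time j w.
Proof.
move=> e0 ij; rewrite ler_pM2r ?invr_gt0//.
exact: (@arrival_nondecreasing _ (fun k => e k w)).
Qed.

Lemma jump_time_ge0 w i : (forall k, 0 <= e k w) -> 0 <= jump_time i w.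
Proof. by move=> e0; rewrite -(jump_time0 w) jump_time_nondecreasing. Qed.

Lemma Xcp_jump_sum w i t : (forall k, 0 <= e k w) ->
  jump_time i w <= t -> t < jump_time i.+1 w -> Xcp lam e Z w t = jump_sum i w.
Proof.
move=> e0 h1 h2; rewrite /Xcp (@NpoisE _ (fun k => e k w) e0 _ i)//.
  by rewrite mulrC -ler_pdivrMr.
by rewrite mulrC -ltr_pdivlMr.
Qed.

Lemma supdist_jump_sumS w i :
  supdist (jump_sum i.+1 w) (jump_sum i w) = supdist (Z i w) (nseq_tuple d 0).
Proof.
apply: eq_bigr => l _; rewrite !tnth_mktuple big_ord_recr/= tnth_nseq subr0.
by rewrite addrAC subrr add0r.
Qed.

(** Gaps are bounded below up to index [n] included: the gap after the last jump keeps the [n]-th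
    level visible for a time [dl]. The bound [2^-1], together with [dl <= 4^-1], keeps the compared
    intervals inside [[0, 1[]. *)
Definition separated_jumps (n : nat) (dl eta : R) (w : T) :=
  [/\ forall k, 0 <= e k w,
      forall k, (k <= n)%N -> lam * dl <= e k w,
      jump_time n w <= 2^-1 &
      forall k, (k < n)%N -> eta <= supdist (Z k w) (nseq_tuple d 0)].

Section two_paths.
Variables (n : nat) (dl eta eps : R) (g : R -> d.-tuple R).
Hypotheses (dl0 : 0 < dl) (dl1 : dl <= 4^-1) (eta0 : 0 < eta).
Hypotheses (epsE : 16 * eps <= dl * eta) (mg : path_adm g).

Let timegap w i : separated_jumps n dl eta w -> (i <= n)%N ->
  jump_time i w + dl <= jump_time i.+1 w.
Proof.
by move=> [_ h _ _] ni; rewrite jump_timeS lerD2l ler_pdivlMr// mulrC; apply: h.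
Qed.

Let time_le w i : separated_jumps n dl eta w -> (i <= n)%N ->
  0 <= jump_time i w <= 2^-1.
Proof.
move=> [e0 _ h _] ni; rewrite jump_time_ge0//=.
by rewrite (le_trans _ h)// jump_time_nondecreasing.
Qed.

Let sum_close w w' i : separated_jumps n dl eta w -> separated_jumps n dl eta w' ->
  (rhoD (Xcp lam e Z w) g <= eps%:E)%E -> (rhoD (Xcp lam e Z w') g <= eps%:E)%E ->
  (i <= n)%N -> `|jump_time i w - jump_time i w'| * eta <= 4 * eps ->
  supdist (jump_sum i w) (jump_sum i w') * dl <= 4 * eps.
Proof.
move=> sw sw' rw rw' ni close.
have [[[dp dq] ep] eE] := (dl0, dl1, eta0, epsE).
have /andP[t0 t1] := time_le sw ni; have /andP[t0' t1'] := time_le sw' ni.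
have gp := timegap sw ni; have gp' := timegap sw' ni.
have [c1 c2] : jump_time i w' <= jump_time i w + dl / 4 /\
               jump_time i w <= jump_time i w' + dl / 4.
  by apply: dist_le_bounds; exact: le_quarter epsE close.
(* From the later of the two [i]-th jump times on, both paths stay at level [i] for a time [dl / 2],
   because that time is within [dl / 4] of both. *)
pose a := Num.max (jump_time i w) (jump_time i w').
have a1 : jump_time i w <= a by rewrite le_max lexx.
have a2 : jump_time i w' <= a by rewrite le_max lexx orbT.
have a3 : a <= jump_time i w + dl / 4 by rewrite ge_max; apply/andP; split; lra.
have a4 : a <= jump_time i w' + dl / 4 by rewrite ge_max; apply/andP; split; lra.
have [e0 _ _ _] := sw; have [e0' _ _ _] := sw'.
suff : (a + dl / 2 - a) * supdist (jump_sum i w) (jump_sum i w') <= 2 * eps by lra.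
apply: (rhoD_common_constancy mg _ _ _ _ _ rw rw'); [lra|lra|lra| |].
- by move=> t /andP[h1 h2]; apply: Xcp_jump_sum => //; lra.
- by move=> t /andP[h1 h2]; apply: Xcp_jump_sum => //; lra.
Qed.

Let time_close w w' i : separated_jumps n dl eta w -> separated_jumps n dl eta w' ->
  (rhoD (Xcp lam e Z w) g <= eps%:E)%E -> (rhoD (Xcp lam e Z w') g <= eps%:E)%E ->
  (i < n)%N -> `|jump_time i w - jump_time i w'| * eta <= 4 * eps ->
  jump_time i.+1 w <= jump_time i.+1 w' ->
  (jump_time i.+1 w' - jump_time i.+1 w) * eta <= 4 * eps.
Proof.
move=> sw sw' rw rw' ni close tle.
have [[[dp dq] ep] eE] := (dl0, dl1, eta0, epsE).
have sc := sum_close sw sw' rw rw' (ltnW ni) close.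
have /andP[t0 t1] := time_le sw ni; have /andP[t0' t1'] := time_le sw' ni.
have gp := timegap sw (ltnW ni); have gp' := timegap sw' (ltnW ni).
have gpS := timegap sw ni.
have [c1 c2] : jump_time i w' <= jump_time i w + dl / 4 /\
               jump_time i w <= jump_time i w' + dl / 4.
  by apply: dist_le_bounds; exact: le_quarter epsE close.
have [e0 _ _ hZ] := sw; have [e0' _ _ _] := sw'.
have eta_le : eta / 2 <= supdist (jump_sum i.+1 w) (jump_sum i w').
  have := hZ i ni; rewrite -supdist_jump_sumS => h.
  have h1 := supdist_triangle (jump_sum i w') (jump_sum i.+1 w) (jump_sum i w).
  have h2 : supdist (jump_sum i w') (jump_sum i w) <= eta / 4.
    by rewrite supdistC -(ler_pM2r dl0); lra.
  lra.
pose a := jump_time i.+1 w.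
(* On [[a, b[] the path of [w] has made jump [i + 1] and that of [w'] has not. The cut at [a + dl]
   guarantees that [w] has not jumped again; the bound [b - a <= dl / 4] then shows that the cut is
   inactive. *)
pose b := Num.min (jump_time i.+1 w') (a + dl).
have b1 : b <= jump_time i.+1 w' by rewrite ge_min lexx.
have b2 : b <= a + dl by rewrite ge_min lexx orbT.
have ab : a <= b by rewrite le_min tle/=; lra.
have : (b - a) * supdist (jump_sum i.+1 w) (jump_sum i w') <= 2 * eps.
  apply: (rhoD_common_constancy mg _ ab _ _ _ rw rw'); rewrite /a in b2 ab *.
  - lra.
  - lra.
  - by move=> t /andP[h1 h2]; apply: Xcp_jump_sum => //; lra.
  - by move=> t /andP[h1 h2]; apply: Xcp_jump_sum => //; lra.
move=> h; have {}h : (b - a) * eta <= 4 * eps.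
  suff : (b - a) * (eta / 2) <= 2 * eps by lra.
  by apply: le_trans h; rewrite ler_wpM2l// subr_ge0.
have : b - a <= dl / 4 by exact: le_quarter epsE h.
move: h; rewrite /b /a => h1 h2.
have [h3|h3] := leP (jump_time i.+1 w') (jump_time i.+1 w + dl).
  by move: h1; rewrite (min_idPl h3).
by move: h2; rewrite (min_idPr (ltW h3)) => h2; lra.
Qed.

(* Before the first bad jump the two paths are close and both constant for a time of
   order [dl]; if the next jump times differed by much, the paths would differ by
   about [eta] in between. *)
Lemma separated_jumps_close w w' i :
  separated_jumps n dl eta w -> separated_jumps n dl eta w' ->
  (rhoD (Xcp lam e Z w) g <= eps%:E)%E -> (rhoD (Xcp lam e Z w') g <= eps%:E)%E ->
  (i <= n)%N -> `|jump_time i w - jump_time i w'| * eta <= 4 * eps /\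
    supdist (jump_sum i w) (jump_sum i w') * dl <= 4 * eps.
Proof.
move=> sw sw' rw rw' ni.
suff h : `|jump_time i w - jump_time i w'| * eta <= 4 * eps.
  by split => //; exact: sum_close.
elim: i ni => [_|i ih ni].
  rewrite !jump_time0 subrr normr0 mul0r mulr_ge0//.
  by rewrite -lee_fin; apply: le_trans rw; exact: rhoD_ge0.
have {}ih := ih (ltnW ni).
have [h|h] := leP (jump_time i.+1 w) (jump_time i.+1 w').
  by rewrite distrC ger0_norm ?subr_ge0//; exact: time_close.
rewrite gtr0_norm ?subr_gt0//; apply: time_close => //; last exact: ltW.
by rewrite distrC.
Qed.

(** Steps and jumps are differences of consecutive jump times and jump sums, each known up to
    [4 * eps] after scaling, hence the factor 8. Thus separated paths near one codeword lie in a
    product of boxes in the coordinates [e], [Z]. *)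
Lemma separated_jumps_box w w' i :
  separated_jumps n dl eta w -> separated_jumps n dl eta w' ->
  (rhoD (Xcp lam e Z w) g <= eps%:E)%E -> (rhoD (Xcp lam e Z w') g <= eps%:E)%E ->
  (i < n)%N -> `|e i w - e i w'| <= 8 * lam * eps / eta /\
    supdist (Z i w) (Z i w') <= 8 * eps / dl.
Proof.
move=> sw sw' rw rw' ni.
have [h1 h2] := separated_jumps_close sw sw' rw rw' (ltnW ni).
have [h3 h4] := separated_jumps_close sw sw' rw rw' ni.
split.
  rewrite ler_pdivlMr//.
  have -> : e i w - e i w' = lam * ((jump_time i.+1 w - jump_time i.+1 w')
      - (jump_time i w - jump_time i w')).
    by rewrite !jump_timeS; field; rewrite gt_eqF.
  rewrite normrM gtr0_norm//.
  have := ler_normB (jump_time i.+1 w - jump_time i.+1 w')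
                    (jump_time i w - jump_time i w').
  rewrite -(ler_pM2r eta0) mulrDl => h5.
  rewrite (_ : 8 * lam * eps = lam * (4 * eps + 4 * eps)); last by ring.
  by rewrite -mulrA ler_pM2l// (le_trans h5)// lerD.
apply: supdist_le => [|l].
  rewrite divr_ge0 ?(ltW dl0)// mulr_ge0// -lee_fin.
  by apply: le_trans rw; exact: rhoD_ge0.
have j1 := ler_tnth_supdist (jump_sum i.+1 w) (jump_sum i.+1 w') l.
have j2 := ler_tnth_supdist (jump_sum i w) (jump_sum i w') l.
have -> : tnth (Z i w) l - tnth (Z i w') l =
    (tnth (jump_sum i.+1 w) l - tnth (jump_sum i.+1 w') l)
    - (tnth (jump_sum i w) l - tnth (jump_sum i w') l).
  by rewrite !tnth_mktuple !big_ord_recr/=; ring.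
apply: (le_trans (ler_normB _ _)).
rewrite ler_pdivlMr//.
apply: (@le_trans _ _ ((supdist (jump_sum i.+1 w) (jump_sum i.+1 w') +
  supdist (jump_sum i w) (jump_sum i w')) * dl)); first by rewrite ler_pM2r// lerD.
lra.
Qed.

End two_paths.
End separation.

(** * Covering in Lebesgue measure *)

Section lebT.
Context {R : realType}.
Local Open Scope ereal_scope.

Lemma lebT_ge0 n (f : n.-tuple R -> \bar R) : (forall x, 0 <= f x) -> 0 <= lebT f.
Proof.
elim: n f => [|n ih] f f0 /=; first exact: f0.
by apply: integral_ge0 => x _; exact: ih.
Qed.

Lemma le_lebT n (f g : n.-tuple R -> \bar R) : (forall x, 0 <= f x) ->
  (forall x, f x <= g x) -> lebT f <= lebT g.
Proof.
elim: n f g => [|n ih] f g f0 fg /=; first exact: fg.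
apply: le_integral_subset => // x _.
- exact: lebT_ge0.
- by apply: lebT_ge0 => t; exact: le_trans (f0 _) (fg _).
- exact: ih.
Qed.

Lemma prode_ge0 (I : Type) (r : seq I) (Q : pred I) (F : I -> \bar R) :
  (forall i, Q i -> 0 <= F i) -> 0 <= \prod_(i <- r | Q i) F i.
Proof. by move=> F0; elim/big_ind: _ => // x y; exact: mule_ge0. Qed.

(** Monotone convergence moves one coordinate integral at a time inside the series. Such sums of
    boxes are measurable in each coordinate, so the iterated integral is computed exactly on them
    and other integrands are compared with them. *)
Lemma lebT_series_box n (c : nat -> nat -> \bar R) (I : nat -> nat -> nat -> set R) :
  (forall k j, 0 <= c k j) -> (forall k j i, measurable (I k j i)) ->
  lebT (fun x : n.-tuple R => \sum_(0 <= k <oo) \sum_(0 <= j <oo)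
      c k j * \prod_(i < n) (\1_(I k j i) (tnth x i))%:E) =
  \sum_(0 <= k <oo) \sum_(0 <= j <oo) c k j * \prod_(i < n) lebesgue_measure (I k j i).
Proof.
elim: n c I => [|n ih] c I c0 mI /=.
  by apply: eq_eseriesr => k _; apply: eq_eseriesr => j _; rewrite !big_ord0.
have ind0 k j i x : 0 <= (\1_(I k j i) x)%:E :> \bar R by rewrite lee_fin.
transitivity (\int[lebesgue_measure]_x \sum_(0 <= k <oo) \sum_(0 <= j <oo)
    (c k j * (\prod_(i < n) lebesgue_measure (I k j i.+1)) *
     (\1_(I k j 0%N) x)%:E)).
  apply: eq_integral => x _.
  transitivity (lebT (fun t : n.-tuple R => \sum_(0 <= k <oo) \sum_(0 <= j <oo)
      (c k j * (\1_(I k j 0%N) x)%:E) *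
      \prod_(i < n) (\1_(I k j i.+1) (tnth t i))%:E)).
    congr (lebT _); apply/funext => t.
    apply: eq_eseriesr => k _; apply: eq_eseriesr => j _.
    rewrite big_ord_recl tnth0 muleA; congr (_ * _).
    by apply: eq_bigr => i _; rewrite tnthS.
  rewrite (ih _ (fun k j i => I k j i.+1))//; last by move=> k j; rewrite mule_ge0.
  apply: eq_eseriesr => k _; apply: eq_eseriesr => j _.
  by rewrite muleAC.
have p0 k j : 0 <= c k j * \prod_(i < n) lebesgue_measure (I k j i.+1).
  by rewrite mule_ge0// prode_ge0.
have q0 k j x : 0 <= c k j * (\prod_(i < n) lebesgue_measure (I k j i.+1)) *
    (\1_(I k j 0%N) x)%:E by rewrite mule_ge0.
have mi k j : measurable_fun setT (fun x => (\1_(I k j 0%N) x)%:E : \bar R).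
  by apply/measurable_EFinP; exact: measurable_indic.
have mq k j : measurable_fun setT (fun x => c k j *
    (\prod_(i < n) lebesgue_measure (I k j i.+1)) * (\1_(I k j 0%N) x)%:E).
  by apply: emeasurable_funM => //; exact: measurable_cst.
rewrite integral_nneseries//; last first.
- by move=> k x _; apply: nneseries_ge0.
- by move=> k; apply: ge0_emeasurable_sum => [j x _ _|j _]; [exact: q0|exact: mq].
apply: eq_eseriesr => k _.
apply: etrans.
  by apply: integral_nneseries => [//|j|j x _]; [exact: mq|exact: q0].
apply: eq_eseriesr => j _.
apply: etrans.
  by apply: ge0_integralZl => [//||x _|]; [exact: mi|exact: ind0|exact: p0].
rewrite integral_indic//; last exact: mI.
by rewrite setIT big_ord_recl -muleA; congr (_ * _); rewrite muleC.
Qed.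

(** Countable subadditivity for the iterated integral: the indicator of [A] lies below the series of
    the indicators of the boxes selected by [c]. *)
Lemma lebesgue_d_cover n (A : set (n.-tuple R)) (c : nat -> nat -> bool)
    (I : nat -> nat -> nat -> set R) :
  (forall k j i, measurable (I k j i)) ->
  (forall x, A x -> exists k j, c k j /\ forall i : 'I_n, I k j i (tnth x i)) ->
  lebesgue_d A <= \sum_(0 <= k <oo) \sum_(0 <= j <oo)
    (c k j)%:R%:E * \prod_(i < n) lebesgue_measure (I k j i).
Proof.
move=> mI cov; have c0 k j : 0 <= ((c k j)%:R : R)%:E by rewrite lee_fin ler0n.
rewrite -lebT_series_box//; apply: le_lebT => [x|x]; first by rewrite lee_fin.
have t0 k j : 0 <= (c k j)%:R%:E * \prod_(i < n) ((\1_(I k j i) (tnth x i))%:E : \bar R).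
  by rewrite mule_ge0// prode_ge0// => i _; rewrite lee_fin.
rewrite indicE; case: (boolP (x \in A)) => [|_]; last first.
  by apply: nneseries_ge0 => k _ _; apply: nneseries_ge0 => j _ _.
rewrite inE => /cov[k [j [ckj Ikj]]].
apply: (@le_trans _ _ (\sum_(0 <= j <oo)
    (c k j)%:R%:E * \prod_(i < n) ((\1_(I k j i) (tnth x i))%:E : \bar R))).
  apply: (le_trans _ (nneseries_lim_ge j.+1 _)) => //.
  rewrite big_nat_recr//= ckj.
  rewrite [X in _ <= _ + _ * X](_ : _ = 1); first by rewrite mule1 leeDr// sume_ge0.
  by rewrite big1// => i _; rewrite indicE mem_set.
apply: (le_trans _ (nneseries_lim_ge k.+1 _)).
  by rewrite big_nat_recr//= leeDr// sume_ge0// => i _; exact: nneseries_ge0.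
by move=> i _ _; exact: nneseries_ge0.
Qed.

End lebT.

(** * Dyadic cubes and the jump law *)

Lemma measure_bigsetU_le {d} {T : measurableType d} {R : realType}
    (mu : {measure set T -> \bar R}) (I : Type) (r : seq I) (F : I -> set T) :
  (forall i, measurable (F i)) ->
  (mu (\big[setU/set0]_(i <- r) F i) <= \sum_(i <- r) mu (F i))%E.
Proof.
move=> mF; elim: r => [|i r ih]; first by rewrite !big_nil measure0.
rewrite !big_cons; apply: (le_trans (measureU2 _ _ _)) => //.
  exact: bigsetU_measurable.
exact: leeD.
Qed.

Lemma measure_bigcup_gt0 {d} {T : measurableType d} {R : realType}
    (mu : {measure set T -> \bar R}) (F : nat -> set T) :
  (forall i, measurable (F i)) -> (0 < mu (\bigcup_i F i))%E ->
  exists i, (0 < mu (F i))%E.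
Proof.
move=> mF; apply: contraPP => /forallNP F0.
have {}F0 i : mu (F i) = 0%E.
  by apply/eqP; rewrite eq_le measure_ge0 andbT leNgt; apply/negP.
apply/negP; rewrite -leNgt.
apply: (le_trans (measure_sigma_subadditive _ mF _ (@subset_refl _ _))).
  exact: bigcupT_measurable.
by rewrite eseries0.
Qed.

(** The inverses telescope to total mass 1, while the weight grows only quadratically, so that its
    logarithm is negligible in the rate. *)
Definition level_weight {R : realType} (k : nat) : R := (k.+1 * k.+2)%:R.

Lemma level_weight_gt0 {R : realType} k : 0 < level_weight k :> R.
Proof. by rewrite ltr0n. Qed.

Lemma nneseries_level_weight {R : realType} :
  (\sum_(0 <= k <oo) ((level_weight k)^-1 : R)%:E <= 1)%E.
Proof.
apply: lime_le.
  by apply: is_cvg_nneseries => k _ _; rewrite lee_fin invr_ge0 ltW ?level_weight_gt0.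
near=> n; suff -> : (\sum_(0 <= k < n) ((level_weight k)^-1 : R)%:E =
    (1 - (n.+1%:R)^-1)%:E)%E by rewrite lee_fin lerBlDr lerDl invr_ge0.
elim: (n) => [|m ih]; first by rewrite big_geq// invr1 subrr.
rewrite big_nat_recr//= ih -EFinD; congr EFin.
rewrite /level_weight natrM -[m.+2%:R]natr1.
have : (m.+1%:R : R) != 0 by rewrite pnatr_eq0.
have : (m.+1%:R + 1 : R) != 0 by rewrite natr1 pnatr_eq0.
by move: (m.+1%:R) => x h1 h2; field; rewrite h1 h2.
Unshelve. all: by end_near. Qed.

Section dyadic.
Context {R : realType} {d : nat}.

Definition cell_itv (k : nat) (m : int) : set R :=
  `[m%:~R / 2 ^+ k, (m + 1)%:~R / 2 ^+ k[%classic.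

Definition dyadic_cell (k : nat) (x : d.-tuple R) : d.-tuple int :=
  [tuple Num.floor (2 ^+ k * tnth x i) | i < d].

(** Integer tuples are numbered by [pickle], so that sums over cubes are series over [nat]; an index
    that codes no tuple gives the empty set. *)
Definition dyadic_cube (k j : nat) : set (d.-tuple R) :=
  [set x | pickle (dyadic_cell k x) = j].

Let pow2 k : 0 < 2 ^+ k :> R. Proof. exact: exprn_gt0. Qed.

Lemma cell_itvE k m x : cell_itv k m x <-> Num.floor (2 ^+ k * x) = m.
Proof.
rewrite /cell_itv /= in_itv/= ler_pdivrMr// ltr_pdivlMr// ![x * _]mulrC -floor_eq.
by split => [/eqP|->].
Qed.

Lemma cell_itv_measurable k m : measurable (cell_itv k m).
Proof. exact: measurable_itv. Qed.

Lemma lebesgue_measure_cell_itv k m :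
  lebesgue_measure (cell_itv k m) = ((2 ^+ k)^-1)%:E :> \bar R.
Proof.
rewrite lebesgue_measure_itv/= lte_fin ltr_pM2r ?invr_gt0// ltr_int ltzD1 lexx.
by rewrite -EFinB -mulrBl intrD addrAC subrr add0r mul1r.
Qed.

Lemma measurable_dyadic_cube k j : measurable (dyadic_cube k j).
Proof.
have [[y jy]|nj] := pselect (exists y : d.-tuple int, pickle y = j); last first.
  suff -> : dyadic_cube k j = set0 by exact: measurable0.
  by apply/seteqP; split => // x xj; apply: nj; exists (dyadic_cell k x).
suff -> : dyadic_cube k j = \bigcap_(i in [set: 'I_d])
    ((fun x : d.-tuple R => tnth x i) @^-1` cell_itv k (tnth y i)).
  apply: fin_bigcap_measurable; first exact: finite_finset.
  move=> i _; rewrite -[X in measurable X]setTI; apply: measurable_tnth => //.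
  exact: cell_itv_measurable.
rewrite /dyadic_cube -jy; apply/seteqP; split => x /=.
  move=> /(pcan_inj pickleK) xy i _ /=; apply/cell_itvE.
  by rewrite -xy tnth_mktuple.
move=> h; congr pickle; apply: eq_from_tnth => i; rewrite tnth_mktuple.
by apply/cell_itvE; exact: h.
Qed.

Lemma trivIset_dyadic_cube k : trivIset setT (dyadic_cube k).
Proof. by move=> i j _ _ [x [/= <- <-]]. Qed.

End dyadic.

Section heavy_cubes.
Context {R : realType} {d : nat} {dT : measure_display} {T : measurableType dT}.
Variables (P : probability T R) (Y : T -> d.-tuple R).
Hypothesis mY : measurable_fun setT Y.

Lemma measurable_preimageT A : measurable A -> measurable (Y @^-1` A).
Proof. by move=> mA; rewrite -[X in measurable X]setTI; exact: mY. Qed.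

(** The mass exceeds the volume by the factor [(K + 1) * level_weight k], which grows with the level
    to make the volumes of heavy cubes summable over all levels at once. *)
Definition heavy (K k j : nat) : bool :=
  ((K.+1%:R * level_weight k * (2 ^+ k)^-1 ^+ d)%:E < P (Y @^-1` dyadic_cube k j))%E.

Definition heavy_set (K : nat) : set (d.-tuple R) :=
  \bigcup_k \bigcup_(j in [set j | heavy K k j]) dyadic_cube k j.

Lemma measurable_heavy_set K : measurable (heavy_set K).
Proof.
apply: bigcupT_measurable => k; apply: bigcup_measurable => j _.
exact: measurable_dyadic_cube.
Qed.

(** Markov's inequality on one level: the volume of a heavy cube is at most a fixed multiple of its
    mass, and the disjoint cubes have total mass at most 1. *)
Lemma heavy_level_volume K k :
  (\sum_(0 <= j <oo) ((heavy K k j)%:R : R)%:E * ((2 ^+ k)^-1 ^+ d)%:E <=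
   ((K.+1%:R)^-1 * (level_weight k)^-1)%:E)%E.
Proof.
have Kw : 0 < K.+1%:R * level_weight k :> R by rewrite mulr_gt0 ?level_weight_gt0.
set a : R := (K.+1%:R)^-1 * (level_weight k)^-1.
have aE : a = (K.+1%:R * level_weight k)^-1 by rewrite /a invfM.
apply: (@le_trans _ _ (\sum_(0 <= j <oo) a%:E * P (Y @^-1` dyadic_cube k j))%E).
  apply: lee_nneseries => [j _ _|j _].
    by rewrite mule_ge0// lee_fin// exprn_ge0// invr_ge0 exprn_ge0.
  case: (boolP (heavy K k j)) => [/ltW hj|_]; last first.
    by rewrite mul0e mule_ge0// lee_fin aE invr_ge0 ltW.
  rewrite mul1e; apply: (@le_trans _ _
      (a%:E * (K.+1%:R * level_weight k * (2 ^+ k)^-1 ^+ d)%:E)%E).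
    by rewrite -EFinM lee_fin aE mulKf ?gt_eqF.
  by rewrite lee_pmul2l// lte_fin aE invr_gt0.
rewrite nneseriesZl; last by move=> j _; exact: measure_ge0.
have mc j : measurable (Y @^-1` dyadic_cube k j).
  by apply: measurable_preimageT; exact: measurable_dyadic_cube.
rewrite -measure_semi_bigcup//.
- rewrite -[leRHS]mule1 lee_pmul2l// ?lte_fin ?aE ?invr_gt0//.
  by apply: probability_le1; exact: bigcupT_measurable.
- by move=> i j _ _ [w [/= h1 h2]]; apply: (@trivIset_dyadic_cube R d k) => //; exists (Y w).
- exact: bigcupT_measurable.
Qed.

(** Sum the level bounds against the inverse weights. This is a dyadic stand-in for the weak-type
    maximal inequality, and it replaces a density of the absolutely continuous component. *)
Lemma lebesgue_d_heavy_set K : (lebesgue_d (heavy_set K) <= (K.+1%:R^-1)%:E)%E.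
Proof.
pose I k j i : set R := cell_itv k
  (nth 0 (if unpickle j is Some z then tval (z : d.-tuple int) else [::]) i).
have -> : K.+1%:R^-1%:E = ((K.+1%:R^-1 : R)%:E * 1)%E by rewrite mule1.
apply: (le_trans (lebesgue_d_cover (c := heavy K) (I := I) _ _)).
- by move=> k j i; exact: cell_itv_measurable.
- move=> x [k _ [j hj xj]]; exists k, j; split => // i.
  by rewrite /I -xj pickleK; apply/cell_itvE; rewrite -tnth_nth tnth_mktuple.
apply: (@le_trans _ _ (\sum_(0 <= k <oo)
    ((K.+1%:R)^-1%:E * ((level_weight k)^-1 : R)%:E))%E).
  apply: lee_nneseries => [k _ _|k _].
    apply: nneseries_ge0 => j _ _; rewrite mule_ge0// ?lee_fin//.
    by rewrite prode_ge0.
  rewrite -EFinM; apply: le_trans (heavy_level_volume K k).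
  apply: lee_nneseries => [j _ _|j _].
    by rewrite mule_ge0// ?lee_fin// prode_ge0.
  under eq_bigr do rewrite lebesgue_measure_cell_itv.
  by rewrite prodEFin prodr_const card_ord.
rewrite nneseriesZl; last first.
  by move=> k _; rewrite lee_fin invr_ge0 ltW// level_weight_gt0.
by apply: lee_wpmul2l; [rewrite lee_fin|exact: nneseries_level_weight].
Qed.

Variable nu : {measure set (d.-tuple R) -> \bar R}.
Hypotheses (nu0 : (0 < nu setT)%E)
  (nuP : forall A, measurable A -> (nu A <= P (Y @^-1` A))%E)
  (nuac : forall A, measurable A -> lebesgue_d A = 0%E -> nu A = 0%E).

(** The intersection of all heavy sets is Lebesgue null, hence [nu]-null; as [nu] is nonzero, it
    charges the complement of some heavy set, and [nu] is dominated by the jump law. *)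
Lemma light_set_gt0 : exists K, (0 < P (Y @^-1` (~` heavy_set K)))%E.
Proof.
have mH K : measurable (~` heavy_set K) by apply: measurableC; exact: measurable_heavy_set.
have mI : measurable (\bigcap_K heavy_set K).
  by apply: bigcapT_measurable => K; exact: measurable_heavy_set.
have [K hK] : exists K, (0 < nu (~` heavy_set K))%E.
  apply: measure_bigcup_gt0 => //; rewrite -setC_bigcap.
  have nI : nu (\bigcap_K heavy_set K) = 0%E.
    apply: nuac => //; apply/eqP; rewrite eq_le; apply/andP; split; last first.
      by apply: lebT_ge0 => x; rewrite lee_fin.
    apply/lee_addgt0Pr => eps eps0; rewrite add0e.
    pose K := Num.truncn eps^-1.
    apply: (@le_trans _ _ (lebesgue_d (heavy_set K))).
      apply: le_lebT => x; first by rewrite lee_fin.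
      rewrite lee_fin !indicE ler_nat; case: (boolP (x \in \bigcap_K _)) => //.
      by rewrite inE => /(_ K I) xK; rewrite mem_set.
    apply: (le_trans (lebesgue_d_heavy_set K)); rewrite lee_fin.
    rewrite -[leRHS]invrK lef_pV2 ?posrE ?invr_gt0//.
    have /truncn_itv/andP[_] : 0 <= eps^-1 by rewrite invr_ge0 ltW.
    exact: ltW.
  rewrite (lt_le_trans nu0)// -(setvU (\bigcap_K heavy_set K)).
  apply: (le_trans (measureU2 nu (measurableC mI) mI)).
  by rewrite -[leRHS]adde0; apply: leeD => //; rewrite -nI.
by exists K; exact: lt_le_trans hK (nuP (mH K)).
Qed.

End heavy_cubes.

Lemma floor_neighbour {R : realType} (a b : R) : `|a - b| <= 1 ->
  exists i : 'I_3, Num.floor a = Num.floor b + i%:Z - 1.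
Proof.
move=> h; have [h1 h2] : b <= a + 1 /\ a <= b + 1 by exact: dist_le_bounds.
have l1 : (Num.floor a < Num.floor b + 2)%R.
  rewrite floor_lt_int; apply: (le_lt_trans h2).
  by have := floorD1_gt b; rewrite !intrD => ?; lra.
have l2 : (Num.floor b < Num.floor a + 2)%R.
  rewrite floor_lt_int; apply: (le_lt_trans h1).
  by have := floorD1_gt a; rewrite !intrD => ?; lra.
have l3 : (absz (Num.floor a - Num.floor b + 1)%R < 3)%N by lia.
by exists (Ordinal l3) => /=; lia.
Qed.

Section thin_set.
Context {R : realType} {d : nat} {dT : measure_display} {T : measurableType dT}.
Variables (P : probability T R) (Y : T -> d.-tuple R).
Hypothesis mY : measurable_fun setT Y.

Section light.
Variables (K : nat) (S : set (d.-tuple R)).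
Hypotheses (mS : measurable S) (SK : S `<=` ~` heavy_set P Y K).

Let bound k : R := K.+1%:R * level_weight k * (2 ^+ k)^-1 ^+ d.

Lemma light_cube k j : (P (Y @^-1` (S `&` dyadic_cube k j)) <= (bound k)%:E)%E.
Proof.
have mj := @measurable_dyadic_cube R d k j.
have [[x [Sx xj]]|n0] := pselect (S `&` dyadic_cube k j !=set0); last first.
  suff -> : S `&` dyadic_cube k j = set0.
    by rewrite preimage_set0 measure0 lee_fin !mulr_ge0// exprn_ge0// invr_ge0 exprn_ge0.
  by apply/seteqP; split => // x Sx; apply: n0; exists x.
apply: (@le_trans _ _ (P (Y @^-1` dyadic_cube k j))).
  apply: le_measure; rewrite ?inE; first exact/measurable_preimageT/measurableI.
    exact: measurable_preimageT.
  by move=> w [].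
rewrite leNgt; apply/negP => hj; apply: (SK Sx).
by exists k => //; exists j.
Qed.

(** A ball of radius [2^-k] is covered by the cube of its centre and the neighbouring cubes, [3 ^ d]
    in all, and a cube that meets [S] is not heavy. *)
Lemma light_ball k x :
  (P (Y @^-1` (S `&` [set y | (supdist y x <= (2 ^+ k)^-1)%R])) <=
    (3 ^+ d * bound k)%:E)%E.
Proof.
have p2 : 0 < 2 ^+ k :> R by exact: exprn_gt0.
pose z (f : {ffun 'I_d -> 'I_3}) : d.-tuple int :=
  [tuple Num.floor (2 ^+ k * tnth x i) + (f i)%:Z - 1 | i < d].
pose F (f : {ffun 'I_d -> 'I_3}) := Y @^-1` (S `&` dyadic_cube k (pickle (z f))).
have mF f : measurable (F f).
  by apply: measurable_preimageT => //; apply: measurableI => //; exact: measurable_dyadic_cube.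
apply: (@le_trans _ _ (P (\big[setU/set0]_f F f))).
  apply: le_measure; rewrite ?inE.
  - apply: measurable_preimageT => //; apply: measurableI => //.
    rewrite -[X in measurable X]setTI.
    have -> : [set y | supdist y x <= (2 ^+ k)^-1] =
        (fun y => supdist y x) @^-1` `]-oo, (2 ^+ k)^-1]%classic.
      by apply/seteqP; split => y /=; rewrite in_itv/=.
    exact: measurable_supdistr.
  - exact: bigsetU_measurable.
  move=> w [SYw /= close].
  have h i : exists j : 'I_3, Num.floor (2 ^+ k * tnth (Y w) i) =
      Num.floor (2 ^+ k * tnth x i) + j%:Z - 1.
    apply: floor_neighbour; rewrite -mulrBr normrM gtr0_norm//.
    rewrite -ler_pdivlMl// mulr1; apply: le_trans close.
    exact: ler_tnth_supdist.
  have [f hf] := choice h.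
  rewrite -bigcup_seq; exists [ffun i => f i]; first by rewrite /= mem_index_enum.
  split => //; rewrite /dyadic_cube/=; congr pickle.
  by apply: eq_from_tnth => i; rewrite !tnth_mktuple hf ffunE.
apply: (le_trans (measure_bigsetU_le _ _ mF)).
apply: (@le_trans _ _ (\sum_(f : {ffun 'I_d -> 'I_3}) (bound k)%:E)%E).
  by apply: lee_sum => f _; exact: light_cube.
by rewrite sumEFin lee_fin sumr_const card_ffun !card_ord -natrX mulr_natl.
Qed.

End light.

(** The jump law has no atom at 0, so a light set of positive mass keeps positive mass after removal
    of some ball around the origin. The constant [K] is [3 ^ d] times the heaviness threshold. *)
Lemma exists_thin_set (nu : {measure set (d.-tuple R) -> \bar R}) :
  (0 < nu setT)%E ->
  (forall A, measurable A -> (nu A <= P (Y @^-1` A))%E) ->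
  (forall A, measurable A -> lebesgue_d A = 0%E -> nu A = 0%E) ->
  P (Y @^-1` [set nseq_tuple d 0]) = 0%E ->
  exists (S : set (d.-tuple R)) (K eta : R), [/\ measurable S, 0 < K, 0 < eta,
    (0 < P (Y @^-1` S))%E /\ (forall x, S x -> eta <= supdist x (nseq_tuple d 0)) &
    forall k x, (P (Y @^-1` (S `&` [set y | (supdist y x <= (2 ^+ k)^-1)%R])) <=
      (K * level_weight k * (2 ^+ k)^-1 ^+ d)%:E)%E].
Proof.
move=> nu0 nuP nuac Y0.
have [K PK] := light_set_gt0 mY nu0 nuP nuac.
have mK : measurable (~` heavy_set P Y K) by apply: measurableC; exact: measurable_heavy_set.
pose F m := ~` heavy_set P Y K `&` [set x | (m.+1%:R^-1 : R) <= supdist x (nseq_tuple d 0)].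
have mF m : measurable (F m).
  apply: measurableI => //; rewrite -[X in measurable X]setTI.
  have -> : [set x | (m.+1%:R^-1 : R) <= supdist x (nseq_tuple d 0)] =
      (fun y => supdist y (nseq_tuple d 0)) @^-1` `[m.+1%:R^-1, +oo[%classic.
    by apply/seteqP; split => y /=; rewrite in_itv/= andbT.
  exact: measurable_supdistr.
have mz : measurable [set nseq_tuple d (0 : R)].
  suff -> : [set nseq_tuple d (0 : R)] = \bigcap_(i in [set: 'I_d])
      ((fun x : d.-tuple R => tnth x i) @^-1` [set 0]).
    apply: fin_bigcap_measurable; first exact: finite_finset.
    by move=> i _; rewrite -[X in measurable X]setTI; apply: measurable_tnth.
  apply/seteqP; split => x /= => [-> i _|h]; first by rewrite /= tnth_nseq.
  by apply: eq_from_tnth => i; rewrite tnth_nseq; exact: h.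
have [m hm] : exists m, (0 < P (Y @^-1` F m))%E.
  apply: measure_bigcup_gt0; first by move=> m; exact: measurable_preimageT.
  rewrite (lt_le_trans PK)//.
  have sub : Y @^-1` (~` heavy_set P Y K) `<=`
      Y @^-1` [set nseq_tuple d 0] `|` \bigcup_m (Y @^-1` F m).
    move=> w hw; have [/eqP y0|y0] := boolP (Y w == nseq_tuple d 0); first by left.
    right; have spos : 0 < supdist (Y w) (nseq_tuple d 0).
      rewrite lt_neqAle supdist_ge0 andbT; apply: contra_neq y0 => y0.
      apply: eq_from_tnth => i; apply/eqP; rewrite -subr_eq0 -normr_le0.
      by rewrite [leRHS]y0 ler_tnth_supdist.
    exists (Num.truncn (supdist (Y w) (nseq_tuple d 0))^-1) => //; split => //=.
    rewrite -[leRHS]invrK lef_pV2 ?posrE ?invr_gt0//.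
    have /truncn_itv/andP[_] : 0 <= (supdist (Y w) (nseq_tuple d 0))^-1.
      by rewrite invr_ge0 ltW.
    exact: ltW.
  have m1 := measurable_preimageT mY mz.
  have m2 : measurable (\bigcup_m (Y @^-1` F m)).
    by apply: bigcupT_measurable => m; exact: measurable_preimageT.
  apply: (@le_trans _ _ (P (Y @^-1` [set nseq_tuple d 0] `|` \bigcup_m (Y @^-1` F m)))).
    apply: le_measure => //; rewrite ?inE//; last exact: measurableU.
    exact: measurable_preimageT.
  apply: (le_trans (measureU2 P m1 m2)).
  by rewrite -[leRHS]add0e; apply: leeD => //; rewrite -Y0.
exists (F m), (3 ^+ d * K.+1%:R), m.+1%:R^-1; split.
- exact: mF.
- by rewrite mulr_gt0// exprn_gt0.
- by rewrite invr_gt0.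
- by split => // x [].
- move=> k x; rewrite -[3 ^+ d * _ * _]mulrA -[3 ^+ d * _ * _]mulrA.
  by apply: light_ball => // y [].
Qed.

End thin_set.

(** * Small balls *)

Section exponential_law.
Context {R : realType}.

Lemma exponential_pdf_le1 (x : R) : exponential_pdf 1 x <= 1.
Proof.
have [x0|x0] := ltP x 0; first by rewrite lt0_exponential_pdf.
by rewrite exponential_pdfE// mul1r mulN1r -expR0 ler_expR oppr_le0.
Qed.

Lemma exponential_prob_le (A : set R) : measurable A ->
  (exponential_prob 1 A <= lebesgue_measure A)%E.
Proof.
move=> mA; rewrite /exponential_prob -[leRHS]mul1e -integral_cst//.
apply: le_integral_subset => // x _.
- by rewrite lee_fin exponential_pdf_ge0.
- by rewrite lee_fin exponential_pdf_le1.
Qed.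

Lemma exponential_prob_itv_ge (a b : R) : 0 <= a -> a <= b ->
  ((expR (- b) * (b - a))%:E <= exponential_prob 1 `[a, b])%E.
Proof.
move=> a0 ab; rewrite EFinM.
have -> : (b - a)%:E = lebesgue_measure (`[a, b]%classic : set R).
  rewrite lebesgue_measure_itv/= lte_fin -EFinB.
  by case: ltP => // ba; rewrite (le_anti (introT andP (conj ab ba))) subrr.
rewrite -integral_cst//; apply: le_integral_subset => // x.
- by move=> _; rewrite lee_fin expR_ge0.
- by move=> _; rewrite lee_fin exponential_pdf_ge0.
- rewrite /= in_itv/= => /andP[ax xb].
  by rewrite lee_fin exponential_pdfE ?(le_trans a0)// mul1r mulN1r ler_expR lerN2.
Qed.

Lemma exponential_prob_lt0 : exponential_prob 1 (`]-oo, 0[%classic : set R) = 0%E.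
Proof.
apply: integral0_eq => x /=; rewrite in_itv/= => x0.
by rewrite lt0_exponential_pdf.
Qed.

End exponential_law.

Lemma big_mine_ge {R : realType} (I : Type) (r : seq I) (F : I -> \bar R) (b : \bar R) :
  (forall i, b <= F i)%E -> (b <= \big[Order.min/+oo]_(i <- r) F i)%E.
Proof.
move=> h; elim/big_ind: _ => [|x y bx by_|i _]; [exact: leey| |exact: h].
by rewrite le_min bx.
Qed.

Lemma prode_le_expr {R : realType} (r : seq nat) (F : nat -> \bar R) (b : R) :
  (forall i, 0 <= F i)%E -> (forall i, F i <= b%:E)%E ->
  (\prod_(i <- r) F i <= (b ^+ size r)%:E)%E.
Proof.
move=> F0 Fb; elim: r => [|i r ih]; first by rewrite big_nil expr0.
rewrite big_cons /= exprS EFinM; apply: lee_pmul => //.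
exact: prode_ge0.
Qed.

Lemma prode_ge_expr {R : realType} (r : seq nat) (F : nat -> \bar R) (b : R) :
  0 <= b -> (forall i, b%:E <= F i)%E ->
  ((b ^+ size r)%:E <= \prod_(i <- r) F i)%E.
Proof.
move=> b0 Fb; elim: r => [|i r ih]; first by rewrite big_nil expr0.
rewrite big_cons /= exprS EFinM; apply: lee_pmul => //.
by rewrite lee_fin exprn_ge0.
Qed.

(** * Probability of separated paths and of small balls *)

Section compound_poisson.
Context {R : realType} {d : nat} {dT : measure_display} {T : measurableType dT}.
Variables (P : probability T R) (lam s : R).
Variables (e : nat -> T -> R) (Z : nat -> T -> d.-tuple R).
Hypotheses (lam0 : 0 < lam) (s0 : 0 < s).
Hypothesis me : forall j, measurable_fun setT (e j).
Hypothesis law_e : forall j (A : set R), measurable A ->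
  P (e j @^-1` A) = exponential_prob 1 A.
Hypothesis mZ : forall i, measurable_fun setT (Z i).
Hypothesis law_Z : forall i (A : set (d.-tuple R)), measurable A ->
  P (Z i @^-1` A) = P (Z 0%N @^-1` A).
Hypothesis ind : indep_eZ P e Z.

(** Exponential steps are nonnegative only almost surely; the pathwise arguments are carried out on
    this event. *)
Definition nonneg_steps : set T := [set w | forall j, 0 <= e j w].

Lemma measurable_e_preimage j A : measurable A -> measurable (e j @^-1` A).
Proof. by move=> mA; rewrite -[X in measurable X]setTI; exact: me. Qed.

Lemma measurable_Z_preimage j A : measurable A -> measurable (Z j @^-1` A).
Proof. by move=> mA; rewrite -[X in measurable X]setTI; exact: mZ. Qed.

Lemma nonneg_stepsE :
  nonneg_steps = \bigcap_j (e j @^-1` (`[0, +oo[%classic : set R)).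
Proof.
apply/seteqP; split => w /=; first by move=> h j _ /=; rewrite in_itv/= andbT.
by move=> h j; have := h j I; rewrite /= in_itv/= andbT.
Qed.

Lemma measurable_nonneg_steps : measurable nonneg_steps.
Proof.
rewrite nonneg_stepsE; apply: bigcapT_measurable => j.
exact: measurable_e_preimage.
Qed.

Lemma prob_nonneg_stepsC : P (~` nonneg_steps) = 0%E.
Proof.
apply/eqP; rewrite eq_le measure_ge0 andbT.
rewrite nonneg_stepsE setC_bigcap.
have mF j : measurable (~` (e j @^-1` (`[0, +oo[%classic : set R))).
  by apply: measurableC; exact: measurable_e_preimage.
apply: (le_trans (measure_sigma_subadditive _ mF _ (@subset_refl _ _))).
  exact: bigcupT_measurable.
rewrite eseries0// => j _ _.
rewrite (_ : ~` _ = e j @^-1` (`]-oo, 0[%classic : set R)).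
  by apply: etrans exponential_prob_lt0; exact: law_e.
by apply/seteqP; split => w /=; rewrite !in_itv/= andbT ltNge => /negP.
Qed.

Definition product_event (m n : nat) (A : nat -> set R) (B : nat -> set (d.-tuple R)) :=
  \bigcap_(j in [set` iota 0 m]) (e j @^-1` A j) `&`
  \bigcap_(k in [set` iota 0 n]) (Z k @^-1` B k).

Lemma product_eventE m n A B w : product_event m n A B w <->
  (forall j, (j < m)%N -> A j (e j w)) /\ (forall k, (k < n)%N -> B k (Z k w)).
Proof.
split=> [[h1 h2]|[h1 h2]]; split.
- by move=> j jm; apply: h1; rewrite /= mem_iota.
- by move=> k kn; apply: h2; rewrite /= mem_iota.
- by move=> j /=; rewrite mem_iota => jm; exact: h1.
- by move=> k /=; rewrite mem_iota => kn; exact: h2.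
Qed.

Lemma measurable_product_event m n A B : (forall j, measurable (A j)) ->
  (forall k, measurable (B k)) -> measurable (product_event m n A B).
Proof.
move=> mA mB; apply: measurableI; apply: bigcap_measurableType => j _.
- exact: measurable_e_preimage.
- exact: measurable_Z_preimage.
Qed.

Lemma prob_product_event m n A B : (forall j, measurable (A j)) ->
  (forall k, measurable (B k)) -> P (product_event m n A B) =
  (\prod_(j <- iota 0 m) P (e j @^-1` A j) *
   \prod_(k <- iota 0 n) P (Z 0%N @^-1` B k))%E.
Proof.
move=> mA mB; rewrite /product_event ind ?iota_uniq//.
by congr (_ * _)%E; apply: eq_bigr => k _; rewrite law_Z.
Qed.

Section lower_bound.
Variables (S : set (d.-tuple R)) (K eta : R).
Hypotheses (mS : measurable S) (K0 : 0 < K) (eta0 : 0 < eta).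
Hypothesis Sgt0 : (0 < P (Z 0%N @^-1` S))%E.
Hypothesis Seta : forall x, S x -> eta <= supdist x (nseq_tuple d 0).
Hypothesis Sthin : forall k x,
  (P (Z 0%N @^-1` (S `&` [set y | (supdist y x <= (2 ^+ k)^-1)%R])) <=
      (K * level_weight k * (2 ^+ k)^-1 ^+ d)%:E)%E.

(** The lower end of the interval gives time gaps of at least [1 / (4 n)], the upper end puts the
    [n]-th jump before time [1 / 2]. *)
Definition separated_event (n : nat) : set T := nonneg_steps `&`
  product_event n.+1 n (fun=> `[lam / (4 * n%:R), lam / (2 * n%:R)]%classic) (fun=> S).

Lemma separated_event_jumps n w : (0 < n)%N -> separated_event n w ->
  separated_jumps lam e Z n (4 * n%:R)^-1 eta w.
Proof.
move=> n0 [w0 /product_eventE[we wZ]].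
have n0' : 0 < n%:R :> R by rewrite ltr0n.
split => [//|k kn||k kn].
- by have := we k; rewrite ltnS => /(_ kn) /=; rewrite in_itv/= => /andP[].
- rewrite /jump_time ler_pdivrMr//.
  apply: (@le_trans _ _ (\sum_(k < n) lam / (2 * n%:R))).
    apply: ler_sum => k _; have := we k; rewrite ltnS => /(_ (ltnW (ltn_ord k))) /=.
    by rewrite in_itv/= => /andP[].
  rewrite sumr_const card_ord -[_ *+ n]mulr_natr.
  by rewrite le_eqVlt; apply/orP; left; apply/eqP; field; rewrite gt_eqF.
- exact/Seta/wZ.
Qed.

Let cG : R := expR (- lam) * (lam / 4) * fine (P (Z 0%N @^-1` S)).

Let pS1 : fine (P (Z 0%N @^-1` S)) <= 1.
Proof.
rewrite -lee_fin fineK ?fin_num_measure//; last exact: measurable_Z_preimage.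
by apply: probability_le1; exact: measurable_Z_preimage.
Qed.

Let pS0 : 0 < fine (P (Z 0%N @^-1` S)).
Proof.
rewrite -lte_fin fineK// fin_num_measure//; exact: measurable_Z_preimage.
Qed.

(** Each of the [n + 1] steps contributes at least [expR (- lam) * lam / (4 n)] and each of the [n]
    jumps the mass of [S]; one further factor at most 1, the mass of [S] again, turns the bound into
    a single power. *)
Lemma prob_separated_event n : (0 < n)%N ->
  (((cG / n%:R) ^+ n.+1)%:E <= P (separated_event n))%E.
Proof.
move=> n0; have n0' : 0 < n%:R :> R by rewrite ltr0n.
pose A : nat -> set R := fun=> `[lam / (4 * n%:R), lam / (2 * n%:R)]%classic.
have mG := @measurable_product_event n.+1 n A (fun=> S)
  (fun=> measurable_itv _) (fun=> mS).
apply: (@le_trans _ _ (P (product_event n.+1 n A (fun=> S)))); last first.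
  rewrite -[leRHS]adde0 -[X in (_ <= _ + X)%E]prob_nonneg_stepsC.
  have mnn := measurable_nonneg_steps.
  apply: (le_trans _ (measureU2 P (measurableI _ _ mnn mG) (measurableC mnn))).
  apply: le_measure; rewrite ?inE//.
    by apply: measurableU; [exact: measurableI|exact: measurableC].
  by move=> w Gw; have [nn|nn] := pselect (nonneg_steps w); [left|right].
rewrite prob_product_event; [|by move=> j; exact: measurable_itv|by []].
pose b : R := expR (- lam) * (lam / 4) / n%:R.
have b0 : 0 <= b by rewrite !mulr_ge0 ?expR_ge0 ?invr_ge0// ltW.
apply: (@le_trans _ _ ((b ^+ n.+1)%:E * ((fine (P (Z 0%N @^-1` S))) ^+ n)%:E)%E).
  rewrite -EFinM lee_fin.
  have -> : cG / n%:R = b * fine (P (Z 0%N @^-1` S)) by rewrite /cG /b mulrAC.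
  rewrite exprMn ler_wpM2l ?exprn_ge0// exprS -[leRHS]mul1r.
  by rewrite ler_wpM2r// exprn_ge0// ltW.
apply: lee_pmul; rewrite ?lee_fin ?exprn_ge0// ?(ltW pS0)//.
- rewrite -[X in b ^+ X](size_iota 0); apply: prode_ge_expr => // j.
  rewrite law_e; last exact: measurable_itv.
  apply: le_trans (exponential_prob_itv_ge _ _).
  + rewrite lee_fin /b -mulrA ler_pM ?expR_ge0 ?mulr_ge0 ?invr_ge0 ?(ltW lam0) ?(ltW n0')//.
      rewrite ler_expR lerN2 ler_pdivrMr ?mulr_gt0// ler_peMr ?(ltW lam0)//.
      by rewrite -natrM ler1n muln_gt0.
    by rewrite le_eqVlt; apply/orP; left; apply/eqP; field; rewrite gt_eqF.
  + by rewrite divr_ge0 ?mulr_ge0 ?(ltW lam0)// ltW.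
  + rewrite ler_pM2l// lef_pV2 ?posrE ?mulr_gt0// ler_pM2r//.
    by rewrite ler_nat.
- rewrite -[X in _ ^+ X](size_iota 0); apply: prode_ge_expr => [|j].
    exact: ltW.
  by rewrite fineK// fin_num_measure//; exact: measurable_Z_preimage.
Qed.

Let CB : R := lam * K / (2 * eta).

(** With [dl = 1 / (4 n)] the jump tolerance [8 * eps / dl] becomes exactly [2^-k], and the step
    tolerance [8 * lam * eps / eta] becomes [lam 2^-k / (4 n eta)]; the latter produces the constant
    [CB]. *)
Let ball_radius (n k : nat) : R := (2 ^+ k)^-1 / (32 * n%:R).

(** If some separated path is near [g], all others near [g] lie in a product of boxes around its
    first [n] steps and jumps. Each jump contributes one factor [2^-k] through its step and [d]
    through its position, hence the exponent [d.+1]. The measurable set [H] encloses the ball. *)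
Lemma separated_small_ball n k g : (0 < n)%N -> path_adm g -> (2 ^+ k)^-1 <= eta / 2 ->
  exists H : set T, [/\ measurable H,
    forall w, separated_event n w ->
      (rhoD (Xcp lam e Z w) g <= (ball_radius n k)%:E)%E -> H w &
    (P H <= ((CB * level_weight k * (2 ^+ k)^-1 ^+ d.+1 / n%:R) ^+ n)%:E)%E].
Proof.
move=> n0 mg keta; have n0' : 0 < n%:R :> R by rewrite ltr0n.
have e0 := eta0; have k0 : 0 < (2 ^+ k)^-1 :> R by rewrite invr_gt0 exprn_gt0.
have b0 : 0 <= CB * level_weight k * (2 ^+ k)^-1 ^+ d.+1 / n%:R.
  rewrite divr_ge0 ?(ltW n0')// mulr_ge0 ?exprn_ge0 ?(ltW k0)//.
  rewrite mulr_ge0 ?(ltW (level_weight_gt0 _))//.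
  by rewrite divr_ge0// mulr_ge0// ltW.
have [[w' [sw' rw']]|none] := pselect (exists w', separated_event n w' /\
    (rhoD (Xcp lam e Z w') g <= (ball_radius n k)%:E)%E); last first.
  exists set0; split => //; last by rewrite measure0 lee_fin exprn_ge0.
  by move=> w sw rw; apply: none; exists w.
pose a : R := lam * (2 ^+ k)^-1 / (4 * n%:R * eta).
pose A j : set R := `[e j w' - a, e j w' + a]%classic.
pose B j : set (d.-tuple R) := S `&` [set y | supdist y (Z j w') <= (2 ^+ k)^-1].
have mA j : measurable (A j) by exact: measurable_itv.
have mB j : measurable (B j).
  apply: measurableI => //; rewrite -[X in measurable X]setTI.
  have -> : [set y | supdist y (Z j w') <= (2 ^+ k)^-1] =
      (fun y => supdist y (Z j w')) @^-1` `]-oo, (2 ^+ k)^-1]%classic.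
    by apply/seteqP; split => y /=; rewrite in_itv/=.
  exact: measurable_supdistr.
exists (product_event n n A B); split; first exact: measurable_product_event.
- move=> w sw rw; apply/product_eventE.
  have [_ /product_eventE[_ wS]] := sw.
  have dl0 : 0 < (4 * n%:R)^-1 :> R by rewrite invr_gt0 mulr_gt0.
  have dl1 : (4 * n%:R)^-1 <= 4^-1 :> R.
    by rewrite lef_pV2 ?posrE ?mulr_gt0// ler_peMr// ler1n.
  have epsE : 16 * ball_radius n k <= (4 * n%:R)^-1 * eta.
    have -> : 16 * ball_radius n k = (4 * n%:R)^-1 * (2 * (2 ^+ k)^-1).
      by rewrite /ball_radius; field; rewrite !gt_eqF// exprn_gt0.
    by rewrite ler_pM2l//; lra.
  have box j : (j < n)%N -> _ := separated_jumps_box lam0 dl0 dl1 eta0 epsE mg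
    (separated_event_jumps n0 sw) (separated_event_jumps n0 sw') rw rw'.
  split => j jn; have [h1 h2] := box j jn.
    move: h1; rewrite (_ : 8 * lam * _ / eta = a); last first.
      by rewrite /a /ball_radius; field; rewrite !gt_eqF// exprn_gt0.
    by move=> /dist_le_bounds[h3 h4]; rewrite /A /= in_itv/=; apply/andP; split; lra.
  split; first exact: wS.
  move: h2; rewrite (_ : 8 * _ / _ = (2 ^+ k)^-1)//.
  by rewrite /ball_radius; field; rewrite !gt_eqF// exprn_gt0.
rewrite prob_product_event//.
have -> : (CB * level_weight k * (2 ^+ k)^-1 ^+ d.+1 / n%:R) ^+ n =
    (2 * a) ^+ n * (K * level_weight k * (2 ^+ k)^-1 ^+ d) ^+ n.
  rewrite -exprMn; congr (_ ^+ n); rewrite exprS /a /CB.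
  move: ((2 ^+ k)^-1) (level_weight k) => x y.
  by field; rewrite !gt_eqF.
have a0 : 0 <= a by rewrite /a !mulr_ge0// ?invr_ge0 ?mulr_ge0// ltW.
rewrite EFinM; apply: lee_pmul; rewrite ?prode_ge0//.
- rewrite -[X in (2 * a) ^+ X](size_iota 0); apply: prode_le_expr => // j.
  rewrite law_e//; apply: (le_trans (exponential_prob_le (mA j))).
  rewrite lebesgue_measure_itv/= lte_fin -EFinB.
  by case: ifP => _; rewrite lee_fin; lra.
- rewrite -[X in _ ^+ X](size_iota 0); apply: prode_le_expr => // j.
  exact: Sthin.
Qed.

(** By [small], the [M] enclosing sets take up at most half of the lower bound for the probability
    of [separated_event]; on the remaining part every codeword is farther away than
    [ball_radius]. *)
Lemma quantization_lower_bound n k M (code : 'I_M -> R -> d.-tuple R) :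
  (0 < n)%N -> (2 ^+ k)^-1 <= eta / 2 -> (forall i, path_adm (code i)) ->
  M%:R * (CB * level_weight k * (2 ^+ k)^-1 ^+ d.+1 / n%:R) ^+ n <=
    (cG / n%:R) ^+ n.+1 / 2 ->
  ((ball_radius n k `^ s * ((cG / n%:R) ^+ n.+1 / 2))%:E <=
   \int[P]_w \big[Order.min/+oo%E]_(i < M) poweR (rhoD (Xcp lam e Z w) (code i)) s)%E.
Proof.
move=> n0 keta adm small.
have [H hH] := choice (fun i => separated_small_ball n0 (adm i) keta).
have mH i : measurable (H i) by case: (hH i).
pose U := \big[setU/set0]_(i < M) H i.
have mU : measurable U by exact: bigsetU_measurable.
have mG : measurable (separated_event n).
  apply: measurableI; first exact: measurable_nonneg_steps.
  by apply: measurable_product_event.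
have PU : (P U <= ((cG / n%:R) ^+ n.+1 / 2)%:E)%E.
  apply: (le_trans (measure_bigsetU_le P _ mH)).
  apply: (@le_trans _ _ (\sum_(i < M)
      ((CB * level_weight k * (2 ^+ k)^-1 ^+ d.+1 / n%:R) ^+ n)%:E)%E).
    by apply: lee_sum => i _; case: (hH i).
  by rewrite sumEFin lee_fin sumr_const card_ord -[_ *+ M]mulr_natl.
have PGU : (((cG / n%:R) ^+ n.+1 / 2)%:E <= P (separated_event n `\` U))%E.
  have h : (((cG / n%:R) ^+ n.+1)%:E <=
      P (separated_event n `\` U) + ((cG / n%:R) ^+ n.+1 / 2)%:E)%E.
    apply: (le_trans (prob_separated_event n0)).
    apply: (@le_trans _ _ (P (separated_event n `\` U) + P U)%E); last exact: leeD2l.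
    apply: (le_trans _ (measureU2 P (measurableD mG mU) mU)).
    apply: le_measure; rewrite ?inE//; first by apply: measurableU => //; exact: measurableD.
    by move=> w Gw; have [uw|uw] := pselect (U w); [right|left].
  rewrite -leeBlDr// in h; apply: le_trans h.
  by rewrite -EFinB lee_fin; lra.
have r0 : 0 <= ball_radius n k.
  by rewrite divr_ge0// ?invr_ge0 ?exprn_ge0 ?mulr_ge0.
apply: (@le_trans _ _ (\int[P]_(w in separated_event n `\` U) (ball_radius n k `^ s)%:E)%E).
  rewrite integral_cst; last exact: measurableD.
  by rewrite EFinM lee_wpmul2l// lee_fin powR_ge0.
apply: le_integral_subset => // [w _|w _|w [Gw nU]].
- by rewrite lee_fin powR_ge0.
- by apply: big_mine_ge => i; exact: poweR_ge0.
apply: big_mine_ge => i; rewrite -poweR_EFin.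
apply: gt0_ler_poweR; rewrite ?in_itv/= ?leey ?andbT ?lee_fin ?(ltW s0) ?rhoD_ge0//.
rewrite leNgt; apply/negP => /ltW lt; apply: nU.
rewrite /U -bigcup_seq; exists i; first by rewrite /= mem_index_enum.
by case: (hH i) => _ h _; exact: h.
Qed.

End lower_bound.
End compound_poisson.

(** * Growth of the rate *)

Lemma ln_sqrt {R : realType} (x : R) : 0 < x -> ln (Num.sqrt x) = ln x / 2.
Proof.
move=> x0; have h : ln x = ln (Num.sqrt x) *+ 2.
  by rewrite -lnXn ?sqrtr_gt0// sqr_sqrtr// ltW.
by rewrite h mulr2n; field.
Qed.

Lemma sqrt_ln_growth {R : realType} (A : R) : 1 <= A -> exists r0 : R, forall r : R,
  r0 <= r -> [/\ 1 <= r, A <= Num.sqrt (ln r) & A * ln r <= Num.sqrt r].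
Proof.
move=> A1; have A0 : 0 < A by lra.
exists (Num.max 1 (Num.max (expR (A ^+ 2)) ((4 * A) ^+ 4))) => r.
rewrite !ge_max => /and3P[r1 rA r4]; have r0 : 0 < r by lra.
split => //.
  rewrite -(@ler_pXn2r _ 2%N)// ?nnegrE ?sqrtr_ge0 ?(ltW A0)// sqr_sqrtr ?ln_ge0//.
  by rewrite -[leLHS]expRK ler_ln ?posrE ?expR_gt0.
(* With the fourth root [q] of [r], [A * ln r = 4 * A * ln q <= 4 * A * q <= q * q]. *)
pose q := Num.sqrt (Num.sqrt r).
have q0 : 0 < q by rewrite !sqrtr_gt0.
have qq : q * q = Num.sqrt r by rewrite -expr2 sqr_sqrtr// sqrtr_ge0.
have lq : ln r = 4 * ln q by rewrite /q !ln_sqrt ?sqrtr_gt0//; field.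
have lqq : ln q <= q by rewrite ltW// ln_sublinear.
have qA : 4 * A <= q.
  rewrite -(@ler_pXn2r _ 4%N)// ?nnegrE; [|lra|lra].
  apply: (le_trans r4); rewrite (_ : q ^+ 4 = (q * q) * (q * q)); last by ring.
  by rewrite qq -expr2 sqr_sqrtr// ltW.
rewrite lq -qq; have := ler_wpM2r (ltW q0) qA; have := ler_wpM2l (ltW A0) lqq; lra.
Qed.

(* In the next two lemmas [u] and [v] stand for the square roots of [r] and [ln r]. *)
Lemma counting_margin {R : realType} (u v N lC lw lc lN l2 A dl : R) :
  1 <= v -> 1 <= A -> A * v ^+ 2 <= u -> 1 <= N -> N <= u -> 0 < dl ->
  lw <= 4 * v ^+ 2 -> lN <= v ^+ 2 -> l2 <= 1 ->
  `|lC| + 2 * `|lc| + 6 <= dl * A ->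
  N * (lC + lw) - (N + 1) * lc + lN + l2 <= dl * u ^+ 2.
Proof.
move=> v1 A1 vu N1 Nu dl0 hlw hlN hl2 hA.
have c0 := normr_ge0 lc; have C0 := normr_ge0 lC.
move: (ler_norm lC) (ler_norm (- lc)); rewrite normrN.
move: `|lC| `|lc| hA c0 C0 => a b hA b0 a0 ha hb.
have v2 : 1 <= v ^+ 2 by nra.
set V := v ^+ 2 in vu hlw hlN v2 *.
have u1 : 1 <= u by lra.
have Au : A <= u by apply: le_trans vu; rewrite ler_peMr//; lra.
(* All terms are of order at most [u * v ^+ 2], which [A * v ^+ 2 <= u] turns into a multiple of
   [u ^+ 2 / A]. *)
apply: (@le_trans _ _ (u * (a + 4 * V + 2 * b) + V + 1)); first by nra.
have : (a + 2 * b + 6) * u <= dl * A * u by rewrite ler_wpM2r//; lra.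
have : u * (a + 4 * V + 2 * b) + V + 1 <= u * (a + 2 * b + 6 * V) by nra.
have h1 : A * (u * (a + 2 * b + 6 * V)) <= u * u * (a + 2 * b + 6).
  rewrite mulrCA -mulrA ler_wpM2l//; first by lra.
  by have := ler_wpM2r a0 Au; have := ler_wpM2r b0 Au; lra.
move=> h2 h3; apply: (le_trans h2).
have A0 : 0 < A by lra.
rewrite -(ler_pM2l A0); apply: (le_trans h1).
have := ler_wpM2r (le_trans ler01 u1) h3.
by rewrite (_ : (a + 2 * b + 6) * u * u = u * u * (a + 2 * b + 6)); [lra|ring].
Qed.

Lemma exponent_margin {R : realType} (u v N kl lc lN l2 l32 A dl b s D1 : R) :
  0 < s -> 0 < D1 -> 0 < b -> b ^+ 2 = 2 * s / D1 ->
  1 <= v -> 1 <= A -> A <= v -> A * v ^+ 2 <= u -> 0 < dl ->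
  b * u / v <= N -> N <= b * u / v + 1 -> 0 <= lN -> lN <= v ^+ 2 / 2 ->
  kl <= (1 + dl) * u ^+ 2 / (N * D1) + 1 -> l2 <= 1 -> l32 <= 32 ->
  2 * (34 * s + 2 + `|lc| * b + 2 * `|lc|) <= dl * b * A ->
  s * (kl + (l32 + lN)) + (N + 1) * (lN - lc) + l2 <= (1 + dl) * (b * u * v).
Proof.
move=> s0 D0 b0 bE v1 A1 Av Au dl0 xN Nx lN0 lNv hkl hl2 h32 hA.
have c0 := normr_ge0 lc.
move: (ler_norm (- lc)); rewrite normrN.
move: `|lc| hA c0 => a hA a0 ha.
have v0 : 0 < v by lra.
have v2 : 1 <= v ^+ 2 by nra.
have u1 : A <= u by apply: le_trans Au; rewrite ler_peMr//; lra.
have u0 : 0 < u by lra.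
have x0 : 0 < b * u / v by rewrite divr_gt0// mulr_gt0.
have N0 : 0 < N by lra.
(* The balance of the two leading terms: since [N >= b * u / v], the resolution term is at most
   [(1 + dl) / 2] times [b * u * v]; the probability term [(N + 1) * lN] adds the other half in
   [h2], up to [v ^+ 2]. What remains is smaller by a factor of order [1 / A]. *)
have main : s * ((1 + dl) * u ^+ 2 / (N * D1)) <= (1 + dl) * (b * u * v) / 2.
  have -> : s * ((1 + dl) * u ^+ 2 / (N * D1)) = (1 + dl) * (s * u ^+ 2 / (D1 * N)).
    by field; rewrite !gt_eqF.
  rewrite -[leRHS]mulrA ler_pM2l; last by lra.
  rewrite ler_pdivrMr ?mulr_gt0//.
  have -> : s * u ^+ 2 = b * u * v / 2 * (D1 * (b * u / v)).
    have -> : s = b ^+ 2 * D1 / 2 by rewrite bE; field; rewrite gt_eqF.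
    by field; rewrite gt_eqF.
  by rewrite ler_pM2l ?divr_gt0 ?mulr_gt0// ler_pM2l.
have h1 : s * kl <= (1 + dl) * (b * u * v) / 2 + s.
  by have := ler_wpM2l (ltW s0) hkl; rewrite mulrDr mulr1; lra.
have h2 : (N + 1) * lN <= b * u * v / 2 + v ^+ 2.
  apply: (@le_trans _ _ ((b * u / v + 2) * (v ^+ 2 / 2))).
    by apply: ler_pM => //; lra.
  by rewrite le_eqVlt; apply/orP; left; apply/eqP; field; rewrite gt_eqF.
have h3 : - ((N + 1) * lc) <= a * (b * u / v) + 2 * a.
  rewrite -mulrN; apply: (@le_trans _ _ ((N + 1) * a)).
    by rewrite ler_wpM2l//; lra.
  by have := ler_wpM2r a0 Nx; lra.
have uv0 : 0 < u * v by rewrite mulr_gt0.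
have A0 : 0 < A by lra.
have k1 : A * (b * u / v) <= b * (u * v).
  rewrite (_ : b * (u * v) = v ^+ 2 * (b * u / v)); last by field; rewrite gt_eqF.
  by rewrite ler_wpM2r ?(ltW x0)//; nra.
have k2 : A * v ^+ 2 <= u * v by apply: (le_trans Au); rewrite ler_peMr// ltW.
have k3 : A <= u * v by apply: (le_trans u1); rewrite ler_peMr// ltW.
have fin : s * 33 + s * (v ^+ 2 / 2) + v ^+ 2 + (a * (b * u / v) + 2 * a) + 1 <=
    dl * (b * u * v) / 2.
  rewrite -(ler_pM2l A0).
  apply: (@le_trans _ _ (u * v * (34 * s + 2 + a * b + 2 * a))).
    have := ler_wpM2l (ltW s0) k2; have := ler_wpM2l (ltW s0) k3.
    have := ler_wpM2l a0 k1; have := ler_wpM2l a0 k3.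
    by have := mulr_ge0 (ltW s0) (ltW uv0); lra.
  by have := ler_wpM2l (ltW uv0) hA; lra.
have h4 : s * l32 <= s * 32 by rewrite ler_wpM2l// ltW.
have h5 : s * lN <= s * (v ^+ 2 / 2) by rewrite ler_wpM2l// ltW.
lra.
Qed.

(** The exponent of the [s]-th power of the error, written [b u v] with [b = sqrt (2 s / D1)]: the
    leading order of the minimum over [n] of [s r / (n D1) + n ln n]. *)
Lemma rate_sqrtE {R : realType} (s D1 r : R) : 0 < s -> 0 < D1 -> 1 <= r ->
  s * Num.sqrt (2 / (s * D1) * r * ln r) =
  Num.sqrt (2 * s / D1) * Num.sqrt r * Num.sqrt (ln r).
Proof.
move=> s0 D0 r1; have L0 : 0 <= ln r by rewrite ln_ge0.
have q0 : 0 <= 2 / (s * D1) * r * ln r.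
  by rewrite mulr_ge0// mulr_ge0; [|rewrite divr_ge0// mulr_ge0// ltW|lra].
have t0 : 0 <= 2 * s / D1 by rewrite divr_ge0 ?mulr_ge0// ltW.
apply: (@pexpIrn _ 2%N); rewrite ?nnegrE ?mulr_ge0 ?sqrtr_ge0 ?(ltW s0)//.
rewrite !exprMn !sqr_sqrtr//; last by lra.
by field; rewrite !gt_eqF.
Qed.

Lemma exprn_expR {R : realType} (n : nat) (x : R) : 0 < x ->
  x ^+ n = expR (n%:R * ln x).
Proof. by move=> x0; rewrite expRM_natl lnK. Qed.

Lemma nat_ceil {R : realType} (x : R) : 0 <= x ->
  exists n : nat, [/\ (0 < n)%N, x <= n%:R & n%:R <= x + 1].
Proof.
move=> /truncn_itv/andP[nx xn]; exists (Num.truncn x).+1; split => //.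
  exact: ltW.
by rewrite -natr1 lerD2r.
Qed.

(** Take [n] as the optimal [b u / v] rounded up, with [u] and [v] the square roots of [r] and
    [ln r], and [2^-k] slightly finer than [exp (- r / (n (1 + d)))]. The excess [dl] in the
    resolution is what makes [exp r] small balls insufficient to fill half of the event. *)
Lemma lower_parameters {R : realType} (s c C eta dl : R) (d : nat) :
  0 < s -> 0 < c -> 0 < C -> 0 < eta -> 0 < dl -> exists r0 : R, forall r, r0 <= r ->
  exists n k : nat, [/\ (0 < n)%N, (2 ^+ k)^-1 <= eta / 2,
    expR r * (C * level_weight k * (2 ^+ k)^-1 ^+ d.+1 / n%:R) ^+ n <=
      (c / n%:R) ^+ n.+1 / 2 &
    expR (- ((1 + dl) * (s * Num.sqrt (2 / (s * (1 + d%:R)) * r * ln r)))) <=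
      ((2 ^+ k)^-1 / (32 * n%:R)) `^ s * ((c / n%:R) ^+ n.+1 / 2)].
Proof.
move=> s0 c0 C0 eta0 dl0.
pose D1 : R := 1 + d%:R; have D0 : 0 < D1 by rewrite ltr_pwDl.
have D1E : D1 = d.+1%:R by rewrite /D1 addrC natr1.
have D1_ge1 : 1 <= D1 by rewrite lerDl.
pose b := Num.sqrt (2 * s / D1).
have b0 : 0 < b by rewrite sqrtr_gt0 divr_gt0// mulr_gt0.
have bE : b ^+ 2 = 2 * s / D1 by rewrite sqr_sqrtr// divr_ge0 ?mulr_ge0// ltW.
pose l2 : R := ln 2.
have l20 : 0 < l2 by rewrite ln_gt0// ltr1n.
have l21 : l2 <= 1 by have := @le_ln1Dx R 1; rewrite /l2 (_ : 1 + 1 = 2)//; apply; lra.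
pose lC := ln C; pose lc := ln c.
pose A1 := (`|lC| + 2 * `|lc| + 6) / dl.
pose A2 := 2 * (34 * s + 2 + `|lc| * b + 2 * `|lc|) / (dl * b).
pose A3 := (1 + dl) / l2 + 3.
pose A4 := 2 * D1 / eta.
have A10 : 0 <= A1 by rewrite divr_ge0 ?addr_ge0 ?mulr_ge0// ltW.
have A20 : 0 <= A2.
  by rewrite divr_ge0 ?mulr_ge0 ?addr_ge0 ?mulr_ge0 ?normr_ge0// ltW.
have A30 : 0 <= A3 by rewrite addr_ge0// divr_ge0 ?addr_ge0// ltW.
have A40 : 0 <= A4 by rewrite divr_ge0 ?mulr_ge0// ltW.
(* [A1] serves [counting_margin], [A2] serves [exponent_margin], [A3] bounds [k + 2] by [u ^+ 4],
   [A4] yields [2^-k <= eta / 2]; the bounds by 2 and [2 * b] ensure [n <= u]. *)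
have [A [A_ge2 Ab AA1 AA2 [AA3 AA4]]] :
    exists A, [/\ 2 <= A, 2 * b <= A, A1 <= A, A2 <= A & A3 <= A /\ A4 <= A].
  by exists (2 + 2 * b + A1 + A2 + A3 + A4); do !split; lra.
have A_ge1 : 1 <= A by apply: le_trans A_ge2; rewrite ler1n.
have [r0 hr0] := @sqrt_ln_growth R A A_ge1.
exists r0 => r /hr0[r1 Av Au].
have tE := rate_sqrtE s0 D0 r1.
set v := Num.sqrt (ln r) in Av tE; set u := Num.sqrt r in Au tE.
have Lv : ln r = v ^+ 2 by rewrite sqr_sqrtr// ln_ge0.
have ru : r = u ^+ 2 by rewrite sqr_sqrtr//; lra.
rewrite Lv in Au.
have v1 : 1 <= v by exact: le_trans Av.
have v0 : 0 < v by exact: lt_le_trans v1.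
have v2 : 1 <= v ^+ 2 by exact: exprn_ege1.
have Au' : A <= u by apply: le_trans Au; rewrite ler_peMr// (le_trans _ A_ge1).
have u_ge1 : 1 <= u by exact: le_trans Au'.
have u0 : 0 < u by exact: lt_le_trans u_ge1.
have lu : ln u = v ^+ 2 / 2 by rewrite ln_sqrt ?Lv//; lra.
pose x := b * u / v.
have x0 : 0 < x by rewrite divr_gt0// mulr_gt0.
have xu : x + 1 <= u.
  have : x <= u / 2.
    rewrite ler_pdivrMr// mulrAC ler_pdivlMr// mulrC mulrA [leRHS]mulrC.
    by rewrite ler_pM2r// (le_trans _ Av).
  by move=> xu2; have u2 := le_trans A_ge2 Au'; clear -xu2 u2; lra.
have [n [n0 xN Nx]] := nat_ceil (ltW x0).
have N1 : 1 <= n%:R :> R by rewrite ler1n.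
set N : R := n%:R in xN Nx N1 *.
have N0 : 0 < N by exact: lt_le_trans N1.
have Nu : N <= u by exact: le_trans Nx xu.
pose lN := ln N.
have lN0 : 0 <= lN by rewrite ln_ge0.
have lNv : lN <= v ^+ 2 / 2 by rewrite -lu ler_ln.
(* Solves [2^-y = exp (- (1 + dl) r / (n (1 + d)))]; [k] is [y] rounded up. *)
pose y := (1 + dl) * u ^+ 2 / (N * D1 * l2).
have y0 : 0 < y.
  by rewrite divr_gt0 ?mulr_gt0// ?exprn_gt0// addr_gt0.
have [k [k0 yka kay]] := nat_ceil (ltW y0).
set ka : R := k%:R in yka kay *.
have p2 : 0 < 2 ^+ k :> R by exact: exprn_gt0.
have kl : ka * l2 <= (1 + dl) * u ^+ 2 / (N * D1) + 1.
  have := ler_wpM2r (ltW l20) kay; rewrite mulrDl mul1r.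
  have -> : y * l2 = (1 + dl) * u ^+ 2 / (N * D1) by rewrite /y; field; rewrite !gt_eqF.
  by move=> h; apply: (le_trans h); rewrite lerD2l.
have klN : (1 + dl) * u ^+ 2 <= N * D1 * (ka * l2).
  have : N * D1 * l2 * y <= N * D1 * l2 * ka by rewrite ler_pM2l// ?mulr_gt0.
  have -> : N * D1 * l2 * y = (1 + dl) * u ^+ 2 by rewrite /y; field; rewrite !gt_eqF.
  by rewrite [ka * l2]mulrC !mulrA.
have yA : y <= (A3 - 3) * u ^+ 2.
  rewrite /A3 addrK /y mulrAC ler_wpM2r ?exprn_ge0 ?(ltW u0)//.
  rewrite ler_pM2l ?addr_gt0//.
  rewrite lef_pV2 ?posrE ?mulr_gt0// ler_peMl ?(ltW l20)//.
  by rewrite (le_trans D1_ge1)// ler_peMl// ltW.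
have u21 : 1 <= u ^+ 2 by exact: exprn_ege1.
(* A polynomial bound on the level suffices: the logarithm of its weight is then at most
   [ln (u ^+ 8) = 4 * v ^+ 2]. *)
have kau : ka + 2 <= u ^+ 4.
  apply: (@le_trans _ _ (A * u ^+ 2)).
    apply: (@le_trans _ _ (A3 * u ^+ 2)); first by clear -kay yA u21; lra.
    by rewrite ler_wpM2r// sqr_ge0.
  rewrite (_ : u ^+ 4 = u ^+ 2 * u ^+ 2); last by ring.
  rewrite ler_wpM2r ?sqr_ge0// (le_trans Au')// expr2.
  by rewrite ler_peMr// ltW.
have w0 : 0 < level_weight k :> R by exact: level_weight_gt0.
pose lw := ln (level_weight k : R).
have hlw : lw <= 4 * v ^+ 2.
  have -> : 4 * v ^+ 2 = ln (u ^+ 8) by rewrite lnXn// lu -mulr_natl; field.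
  rewrite ler_ln ?posrE ?exprn_gt0//.
  rewrite /level_weight natrM -!natr1 -/ka.
  rewrite (_ : u ^+ 8 = u ^+ 4 * u ^+ 4); last by ring.
  have ka0 : 0 <= ka by exact: ler0n.
  by apply: ler_pM; clear -kau ka0; lra.
have m1 : N * (lC + lw) - (N + 1) * lc + lN + l2 <= dl * u ^+ 2.
  apply: (@counting_margin _ u v _ _ _ _ _ _ A) => //.
    by apply: (le_trans lNv); clear -v2; lra.
  rewrite (_ : _ + 6 = dl * A1); last by rewrite /A1; field; rewrite gt_eqF.
  by rewrite ler_pM2l.
have m2 : s * (ka * l2 + (ln 32 + lN)) + (N + 1) * (lN - lc) + l2 <=
    (1 + dl) * (b * u * v).
  apply: (@exponent_margin _ u v _ _ _ _ _ _ A _ _ _ D1) => //.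
    by rewrite ltW// ln_sublinear.
  rewrite (_ : 2 * _ = dl * b * A2); last by rewrite /A2; field; rewrite !gt_eqF.
  by rewrite ler_pM2l ?mulr_gt0.
have p2E : (2 ^+ k)^-1 = expR (- (ka * l2)) by rewrite expRN exprn_expR.
have nE : N = expR lN by rewrite lnK.
have cE : (c / N) ^+ n.+1 / 2 = expR ((N + 1) * (lc - lN) - l2).
  rewrite exprn_expR ?divr_gt0// ln_div ?posrE// -natr1 expRB /l2 lnK//.
  by rewrite posrE.
exists n, k; split => //.
- rewrite -[leRHS]invrK lef_pV2 ?posrE ?invr_gt0 ?divr_gt0//.
  apply: (@le_trans _ _ ka); last first.
    by rewrite /ka -natrX ler_nat ltnW// ltn_expl.
  apply: le_trans yka; rewrite invf_div /y.
  rewrite ler_pdivlMr ?mulr_gt0//.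
  apply: (@le_trans _ _ (u ^+ 2)); last by rewrite ler_peMl ?sqr_ge0// lerDl ltW.
  apply: (@le_trans _ _ (2 / eta * (u * D1 * 1))).
    rewrite ler_pM2l ?divr_gt0//; apply: ler_pM => //; [|exact: ltW|].
      by rewrite mulr_ge0// ltW.
    by rewrite ler_pM2r.
  rewrite (_ : 2 / eta * (u * D1 * 1) = A4 * u); last by rewrite /A4; field; rewrite gt_eqF.
  by rewrite expr2 ler_pM2r// (le_trans AA4).
- rewrite cE -/N.
  have -> : C * level_weight k * (2 ^+ k)^-1 ^+ d.+1 / N =
      expR (lC + lw - D1 * (ka * l2) - lN).
    rewrite !expRB expRD /lC /lw /lN !lnK ?posrE// D1E expRM_natl.
    by rewrite p2E expRN exprVn.
  rewrite -expRM_natl -expRD ler_expR ru -/N; clear -m1 klN; lra.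
- have -> : ((2 ^+ k)^-1 / (32 * n%:R)) `^ s = expR (s * (- (ka * l2) - (ln 32 + lN))).
    rewrite /powR gt_eqF ?divr_gt0 ?invr_gt0 ?mulr_gt0//; congr (expR (s * _)).
    rewrite ln_div ?posrE ?invr_gt0 ?mulr_gt0// lnM ?posrE// p2E expRK.
    by [].
  rewrite cE tE -/b -expRD ler_expR -/N; clear -m2; lra.
Qed.

(** * Logarithmic rates, and the lower bound on the error *)

Section ereal_rates.
Context {R : realType}.
Local Open Scope ereal_scope.

Lemma neg_lne_le (D : \bar R) (a : R) : (expR (- a))%:E <= D -> - lne D <= a%:E.
Proof.
move=> h; rewrite leeNl -EFinN -[(- a)%R]expRK -lne_EFin ?expR_gt0//.
rewrite lee_lne// in_itv/= leey andbT ?lee_fin ?expR_ge0//.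
by apply: le_trans h; rewrite lee_fin expR_ge0.
Qed.

Lemma neg_lne_ge (D : \bar R) (a : R) : 0 <= D -> D <= (expR (- a))%:E -> a%:E <= - lne D.
Proof.
move=> D0 h; rewrite leeNr -EFinN -[(- a)%R]expRK -lne_EFin ?expR_gt0//.
by rewrite lee_lne// in_itv/= leey andbT// lee_fin expR_ge0.
Qed.

Lemma limf_esup_le (T : choiceType) (X : filteredType T) (f : X -> \bar R)
    (F : set (set X)) (l : R) :
  (forall dl : R, (0 < dl)%R -> F [set x | f x <= (l + dl)%:E]) ->
  limf_esup f F <= l%:E.
Proof.
move=> h; rewrite limf_esupE; apply/lee_addgt0Pr => dl dl0.
apply: (@le_trans _ _ (ereal_sup (f @` [set x | f x <= (l + dl)%:E]))).
  by apply: ereal_inf_lbound; exists [set x | f x <= (l + dl)%:E] => //; exact: h.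
by apply: ge_ereal_sup => _ [x /= hx <-].
Qed.

Lemma limf_esup_lt (T : choiceType) (X : filteredType T) (f : X -> \bar R)
    (F : set (set X)) (l : \bar R) :
  (forall A B, A `<=` B -> F A -> F B) ->
  limf_esup f F < l -> F [set x | f x < l].
Proof.
move=> FS; rewrite limf_esupE => /ereal_inf_lt[_ [V FV <-] lt].
apply: FS FV => x Vx /=; apply: le_lt_trans lt.
by apply: ereal_sup_ubound; exists x.
Qed.

End ereal_rates.

Lemma expR_powR {R : realType} (a b : R) : expR a `^ b = expR (a * b).
Proof. by rewrite /powR gt_eqF ?expR_gt0// expRK mulrC. Qed.

Section lower_rate.
Context {R : realType} {d : nat} {dT : measure_display} {T : measurableType dT}.
Variables (P : probability T R) (lam s : R).
Variables (e : nat -> T -> R) (Z : nat -> T -> d.-tuple R).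
Hypotheses (lam0 : 0 < lam) (s0 : 0 < s).
Hypothesis me : forall j, measurable_fun setT (e j).
Hypothesis law_e : forall j (A : set R), measurable A ->
  P (e j @^-1` A) = exponential_prob 1 A.
Hypothesis mZ : forall i, measurable_fun setT (Z i).
Hypothesis law_Z : forall i (A : set (d.-tuple R)), measurable A ->
  P (Z i @^-1` A) = P (Z 0%N @^-1` A).
Hypothesis ind : indep_eZ P e Z.
Hypothesis Z0 : P (Z 0%N @^-1` [set nseq_tuple d 0]) = 0%E.
Variable nu : {measure set (d.-tuple R) -> \bar R}.
Hypotheses (nu0 : (0 < nu setT)%E)
  (nuP : forall A, measurable A -> (nu A <= P (Z 0%N @^-1` A))%E)
  (nuac : forall A, measurable A -> lebesgue_d A = 0%E -> nu A = 0%E).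

Lemma Dq_lower_rate (dl : R) : 0 < dl -> exists r0, forall r, r0 <= r ->
  ((expR (- ((1 + dl) * Num.sqrt (2 / (s * (1 + d%:R)) * r * ln r))))%:E <=
   Dq P (Xcp lam e Z) (@rhoD R d) (@path_adm R d) s r)%E.
Proof.
move=> dl0.
have [S [K [eta [mS K0 eta0 [Sgt0 Seta] Sthin]]]] :=
  exists_thin_set (mZ 0%N) nu0 nuP nuac Z0.
have mZS : measurable (Z 0%N @^-1` S) by exact: measurable_Z_preimage.
have pS0 : 0 < fine (P (Z 0%N @^-1` S)).
  by rewrite -lte_fin fineK// fin_num_measure.
have c0 : 0 < expR (- lam) * (lam / 4) * fine (P (Z 0%N @^-1` S)).
  by rewrite !mulr_gt0// expR_gt0.
have C0 : 0 < lam * K / (2 * eta) by rewrite divr_gt0// mulr_gt0.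
have [r0 hr0] := lower_parameters d s0 c0 C0 eta0 dl0.
exists r0 => r /hr0[n [k [n0 keta small big]]].
apply: le_ereal_inf_tmp => _ [[M code] /= [M1 [adm lnM]] <-].
have Mr : M%:R <= expR r by rewrite -[leLHS]lnK ?posrE ?ltr0n// ler_expR.
have lb := quantization_lower_bound lam0 s0 me law_e mZ law_Z ind mS K0 eta0
  Sgt0 Seta Sthin n0 keta adm.
apply: (@le_trans _ _ (poweR (expR (- ((1 + dl) *
    (s * Num.sqrt (2 / (s * (1 + d%:R)) * r * ln r)))))%:E s^-1)).
  rewrite poweR_EFin expR_powR lee_fin ler_expR le_eqVlt; apply/orP; left.
  by apply/eqP; field; rewrite gt_eqF.
apply: gt0_ler_poweR; first by rewrite invr_ge0 ltW.
- by rewrite in_itv/= leey andbT lee_fin expR_ge0.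
- rewrite in_itv/= leey andbT.
  by apply: integral_ge0 => w _; apply: big_mine_ge => i; exact: poweR_ge0.
apply: le_trans (lb _); first by rewrite lee_fin.
apply: le_trans small; apply: ler_wpM2r => //.
rewrite exprn_ge0// divr_ge0// mulr_ge0 ?exprn_ge0 ?invr_ge0 ?exprn_ge0//.
by rewrite mulr_ge0 ?(ltW C0)// ltW// level_weight_gt0.
Qed.

End lower_rate.

(** * Poisson tail *)

Section integral_event.
Context {d1 d2 : measure_display} {T : measurableType d1} {U : measurableType d2}.
Context {R : realType}.
Variable P : {measure set T -> \bar R}.
Import HBNNSimple.

(** A simple function below [f] cut off outside [E] takes its nonzero values inside [E], so its
    integral is the same for the restricted measure. *)
Lemma integral_le_mrestr (E : set T) (mE : measurable E) (f : T -> \bar R) :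
  (forall x, 0 <= f x)%E ->
  (\int[P]_(x in E) f x <= \int[mrestr P mE]_x f x)%E.
Proof.
move=> f0; rewrite !ge0_integralE// patch_setT.
apply: ge_ereal_sup => _ [h /= hf <-].
apply: ereal_sup_ubound; exists h => /= [x|].
  by apply: (le_trans (hf x)); rewrite patchE; case: ifP.
apply: eq_fsbigr => x _.
have [->|x0] := eqVneq x 0; first by rewrite !mul0e.
rewrite /mrestr setIidl// => t /= htx.
have := hf t; rewrite patchE; case: ifPn => [|_]; first by rewrite inE.
rewrite htx lee_fin => xle0; have : 0 <= h t by [].
by rewrite htx => xge0; move: x0; rewrite (le_anti (introT andP (conj xle0 xge0))) eqxx.
Qed.

(** Compare the image of [P] restricted to [E] under [X] with [q] times the image of [P] under [Y].
    Applied to [Z l], [Z 0] and the event of many jumps, it separates the cost of a jump from the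
    number of jumps. *)
Lemma integral_event_le (E : set T) (X Y : T -> U) (q : R) (h : U -> \bar R) :
  measurable E -> measurable_fun setT X -> measurable_fun setT Y -> 0 <= q ->
  (forall B, measurable B ->
    P (E `&` X @^-1` B) <= q%:E * P (Y @^-1` B))%E ->
  measurable_fun setT h -> (forall u, 0 <= h u)%E ->
  (\int[P]_(w in E) h (X w) <= q%:E * \int[P]_w h (Y w))%E.
Proof.
move=> mE mX mY q0 dom mh h0.
apply: (le_trans (integral_le_mrestr mE _)) => [w|]; first exact: h0.
pose X' : {mfun T >-> U} := HB.pack X (isMeasurableFun.Build _ _ _ _ _ mX).
pose Y' : {mfun T >-> U} := HB.pack Y (isMeasurableFun.Build _ _ _ _ _ mY).
have -> : (\int[mrestr P mE]_w h (X w) = \int[pushforward (mrestr P mE) X']_u h u)%E.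
  by rewrite ge0_integral_pushforward.
have -> : (\int[P]_w h (Y w) = \int[pushforward P Y']_u h u)%E.
  by rewrite ge0_integral_pushforward.
rewrite -[q]/((NngNum q0)%:num) -ge0_integral_mscale//.
apply: ge0_le_measure_integral => // B mB.
by have := dom B mB; rewrite setIC.
Qed.

End integral_event.

(** Each admissible [f] has weight [2 ^ m * 2 ^ (- sum f) >= 1], and the weights of all functions
    factor into [m] geometric sums, each at most 2. *)
Lemma card_bounded_sum (m : nat) :
  (#|[pred f : {ffun 'I_m -> 'I_m.+1} | (\sum_j f j <= m)%N]| <= 4 ^ m)%N.
Proof.
rewrite -(ler_nat rat).
pose F (f : {ffun 'I_m -> 'I_m.+1}) : rat := 2 ^+ m * \prod_j (2^-1 ^+ f j).
have F0 f : 0 <= F f by rewrite mulr_ge0 ?exprn_ge0// prodr_ge0// => j _; rewrite exprn_ge0.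
apply: (@le_trans _ _ (\sum_f F f)).
  rewrite -sum1_card natr_sum big_mkcond; apply: ler_sum => f _.
  rewrite inE; case: ifP => // fm.
  rewrite /F (_ : \prod_j _ = (2 ^+ (\sum_j f j)%N)^-1); last first.
    rewrite -prodrXr -prodfV; apply: eq_bigr => j _.
    by rewrite exprVn.
  by rewrite ler_pdivlMr ?exprn_gt0// mul1r ler_eXn2l.
rewrite -mulr_sumr -(bigA_distr_bigA (fun _ k => 2^-1 ^+ (nat_of_ord k) : rat))/=.
rewrite prodr_const card_ord.
have h : \sum_(k < m.+1) (2^-1 ^+ k : rat) <= 2.
  have -> : \sum_(k < m.+1) (2^-1 ^+ k : rat) = 2 - 2^-1 ^+ m.
    elim: m {F F0} => [|m ih]; first by rewrite big_ord1 !expr0; field.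
    by rewrite big_ord_recr/= ih exprS; field.
  by rewrite lerBlDr lerDl exprn_ge0.
rewrite (_ : 4 = 2 * 2)%N// expnMn natrM !natrX ler_pM2l ?exprn_gt0//.
by rewrite lerXn2r ?nnegrE// sumr_ge0// => k _; rewrite exprn_ge0.
Qed.

Section poisson_tail.
Context {R : realType} {d : nat} {dT : measure_display} {T : measurableType dT}.
Variables (P : probability T R) (lam : R).
Variables (e : nat -> T -> R) (Z : nat -> T -> d.-tuple R).
Hypothesis lam0 : 0 < lam.
Hypothesis me : forall j, measurable_fun setT (e j).
Hypothesis law_e : forall j (A : set R), measurable A ->
  P (e j @^-1` A) = exponential_prob 1 A.
Hypothesis mZ : forall i, measurable_fun setT (Z i).
Hypothesis law_Z : forall i (A : set (d.-tuple R)), measurable A ->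
  P (Z i @^-1` A) = P (Z 0%N @^-1` A).
Hypothesis ind : indep_eZ P e Z.

Definition many_jumps (m : nat) : set T :=
  nonneg_steps e `&` [set w | \sum_(j < m) e j w <= lam].

Lemma measurable_many_jumps m : measurable (many_jumps m).
Proof.
apply: measurableI; first exact: measurable_nonneg_steps.
rewrite -[X in measurable X]setTI.
have -> : [set w | \sum_(j < m) e j w <= lam] =
    (fun w => \sum_(j < m) e j w) @^-1` (`]-oo, lam]%classic : set R).
  by apply/seteqP; split => w /=; rewrite in_itv/=.
by apply: measurable_sum.
Qed.

(* A discretized Chernoff bound: the steps are rounded down to multiples of
   [lam / m], which leaves at most [4 ^ m] product events. *)
Lemma prob_many_jumps m i B : measurable B ->
  (P (many_jumps m.+1 `&` Z i @^-1` B) <=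
    ((4 * lam / m.+1%:R) ^+ m.+1)%:E * P (Z 0%N @^-1` B))%E.
Proof.
move=> mB; set M := m.+1; pose q : R := lam / M%:R.
have M0 : 0 < M%:R :> R by rewrite ltr0n.
have q0 : 0 < q by rewrite divr_gt0.
pose A (f : {ffun 'I_M -> 'I_M.+1}) (j : nat) : set R :=
  `[(f (inord j))%:R * q, (f (inord j)).+1%:R * q[%classic.
(* The condition on [Z i] is carried along in every product event; this is what decouples a single
   jump from the number of jumps. *)
pose F f := \bigcap_(j in [set` iota 0 M]) (e j @^-1` A f j) `&`
            \bigcap_(k in [set` [:: i]]) (Z k @^-1` B).
have mF f : measurable (F f).
  apply: measurableI; apply: bigcap_measurableType => j _.
    by apply: measurable_e_preimage => //; exact: measurable_itv.
  exact: measurable_Z_preimage.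
have PF f : (P (F f) <= (q ^+ M)%:E * P (Z 0%N @^-1` B))%E.
  rewrite /F (ind (B := fun=> B)) ?iota_uniq//; last by move=> j; exact: measurable_itv.
  rewrite big_seq1 law_Z//; apply: lee_wpmul2r => //.
  rewrite -[X in q ^+ X](size_iota 0); apply: prode_le_expr => // j.
  rewrite law_e; last exact: measurable_itv.
  apply: (le_trans (exponential_prob_le (measurable_itv _))).
  rewrite lebesgue_measure_itv/= lte_fin ltr_pM2r// ltr_nat ltnSn -EFinB lee_fin.
  by rewrite -mulrBl -natr1 addrAC subrr add0r mul1r.
pose Q := [pred f : {ffun 'I_M -> 'I_M.+1} | (\sum_j f j <= M)%N].
apply: (@le_trans _ _ (P (\big[setU/set0]_(f <- enum Q) F f))).
  apply: le_measure; rewrite ?inE.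
  - apply: measurableI; first exact: measurable_many_jumps.
    exact: measurable_Z_preimage.
  - exact: bigsetU_measurable.
  move=> w [[nn sumle] Zw].
  have k0 j : 0 <= e j w / q by rewrite divr_ge0 ?nn// ltW.
  have trunc_le j : (Num.truncn (e j w / q))%:R <= e j w / q.
    by have /truncn_itv/andP[] := k0 j.
  have sum_le : (\sum_(j < M) Num.truncn (e j w / q)  <= M)%N.
    rewrite -(ler_nat R) natr_sum.
    apply: (@le_trans _ _ (\sum_(j < M) e j w / q)); first exact: ler_sum.
    rewrite -mulr_suml ler_pdivrMr//; apply: (le_trans sumle).
    by rewrite /q mulrCA divff ?mulr1// gt_eqF.
  have tle (j : 'I_M) : (Num.truncn (e j w / q) <= M)%N.
    by apply: leq_trans sum_le; rewrite (bigD1 j)//= leq_addr.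
  pose f : {ffun 'I_M -> 'I_M.+1} := [ffun j : 'I_M => inord (Num.truncn (e j w / q))].
  have fE (j : 'I_M) : f j = Num.truncn (e j w / q) :> nat by rewrite ffunE inordK ?ltnS.
  rewrite -bigcup_seq; exists f.
    rewrite /= mem_enum inE; apply: leq_trans sum_le.
    by rewrite leq_eqVlt; apply/orP; left; apply/eqP/eq_bigr => j _.
  split => [j jI|k].
    have jM : (j < M)%N by have : j \in iota 0 M by []; rewrite mem_iota.
    rewrite /A /= in_itv/= fE inordK//.
    rewrite -ler_pdivlMr// -ltr_pdivrMr//.
    by have /truncn_itv := k0 j.
  by rewrite /= inE => /eqP ->.
apply: (le_trans (measure_bigsetU_le _ _ mF)).
apply: (@le_trans _ _ (\sum_(f <- enum Q) (q ^+ M)%:E * P (Z 0%N @^-1` B))%E).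
  by apply: lee_sum => f _; exact: PF.
have pE : P (Z 0%N @^-1` B) = (fine (P (Z 0%N @^-1` B)))%:E.
  by rewrite fineK// fin_num_measure//; exact: measurable_Z_preimage.
rewrite pE -!EFinM sumEFin lee_fin big_enum sumr_const -[_ *+ _]mulr_natl mulrA.
apply: ler_wpM2r; first by rewrite fine_ge0.
have -> : 4 * lam / M%:R = 4 * q by rewrite /q mulrA.
rewrite [leRHS]exprMn ler_wpM2r ?exprn_ge0 ?(ltW q0)//.
by rewrite -natrX ler_nat; exact: card_bounded_sum.
Qed.

End poisson_tail.

(** * Coding of paths *)

(** Each [F i] is at most the [1 / s] power of the sum of the [s]-th powers. This covers every
    [s > 0], convex or concave, and the constant is only polynomial in the number of terms. *)
Lemma powR_sum_le {R : realType} (I : Type) (r : seq I) (F : I -> R) (s : R) :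
  0 < s -> (forall i, 0 <= F i) ->
  (\sum_(i <- r) F i) `^ s <= (size r)%:R `^ s * \sum_(i <- r) F i `^ s.
Proof.
move=> s0 F0.
have S0 (q : seq I) : 0 <= \sum_(i <- q) F i `^ s.
  by apply: sumr_ge0 => i _; exact: powR_ge0.
suff : \sum_(i <- r) F i <= (size r)%:R * (\sum_(i <- r) F i `^ s) `^ s^-1.
  move=> h; have := ge0_ler_powR (ltW s0) _ _ h.
  rewrite !nnegrE powRM ?powR_ge0// -powRrM mulVf ?gt_eqF// powRr1//.
  by apply; [exact: sumr_ge0|rewrite mulr_ge0// powR_ge0].
elim: r => [|i r ih]; first by rewrite !big_nil mul0r.
rewrite !big_cons /= -nat1r mulrDl mul1r.
have mono x y : 0 <= x -> x <= y -> x `^ s^-1 <= y `^ s^-1.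
  move=> x0 xy; apply: ge0_ler_powR; rewrite ?nnegrE ?invr_ge0 ?(ltW s0)//.
  exact: le_trans xy.
apply: lerD.
  rewrite -[leLHS]powRr1// -(@mulfV _ s) ?gt_eqF// powRrM.
  by apply: mono; rewrite ?powR_ge0// lerDl.
apply: (le_trans ih); rewrite ler_wpM2l//.
by apply: mono; rewrite ?S0// lerDr powR_ge0.
Qed.

Lemma big_mine_attained {R : realType} (L : nat) (F : 'I_L -> \bar R) : (0 < L)%N ->
  exists i, \big[Order.min/+oo%E]_(i < L) F i = F i.
Proof.
case: L F => // L F _; elim: L F => [|L ih] F.
  by exists ord0; rewrite big_ord1.
have [i hi] := ih (fun i => F (lift ord0 i)).
rewrite big_ord_recl hi; have [h|h] := leP (F ord0) (F (lift ord0 i)).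
  by exists ord0.
by exists (lift ord0 i).
Qed.

Section step_paths.
Context {R : realType} {d : nat}.

Definition step_path (m : nat) (tau : 'I_m -> R) (a : 'I_m -> d.-tuple R) (t : R) :
    d.-tuple R :=
  [tuple \sum_(l < m) (if tau l <= t then tnth (a l) k else 0) | k < d].

Lemma path_adm_step m (tau : 'I_m -> R) a : path_adm (step_path tau a).
Proof.
apply: measurable_funTS; apply/measurable_fun_tnthP => k.
have -> : (fun x => tnth x k) \o step_path tau a =
    (fun t => \sum_(l < m) (if tau l <= t then tnth (a l) k else 0)).
  by apply/funext => t /=; rewrite tnth_mktuple.
apply: measurable_sum => l.
apply: measurable_fun_ifT => //.
exact: measurable_fun_ler.
Qed.

(** Outside [[tau' l, tau l[] the [l]-th summands differ by at most the distance of [a l] and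
    [a' l]; inside, the norm of [a l] is added. Coded times are rounded down, hence the order of
    [tau'] and [tau]. *)
Lemma rhoD_step_path m (tau tau' : 'I_m -> R) (a a' : 'I_m -> d.-tuple R) :
  (forall l, tau' l <= tau l) ->
  (rhoD (step_path tau a) (step_path tau' a') <=
   (\sum_(l < m) (supdist (a l) (nseq_tuple d 0) * (tau l - tau' l) +
                  supdist (a l) (a' l)))%:E)%E.
Proof.
move=> tle.
pose b l : R := supdist (a l) (nseq_tuple d 0).
pose c l : R := supdist (a l) (a' l).
have b0 l : 0 <= b l by exact: supdist_ge0.
have c0 l : 0 <= c l by exact: supdist_ge0.
pose J l : set R := `[tau' l, tau l[%classic.
have mJ l : measurable (J l) by exact: measurable_itv.
have mE l : measurable_fun (`[0%R, 1%R[ : set R) (fun t => ((b l)%:E * (\1_(J l) t)%:E)%E).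
  apply: measurable_funTS; apply/measurable_EFinP.
  by apply: measurable_funM => //; exact: measurable_indic.
have bj0 l t : (0 <= (b l)%:E * (\1_(J l) t)%:E)%E by rewrite mule_ge0// lee_fin.
apply: (@le_trans _ _ (\int[lebesgue_measure]_(t in `[0%R, 1%R[)
    \sum_(l < m) ((b l)%:E * (\1_(J l) t)%:E + (c l)%:E))%E).
  apply: le_integral_subset => // t _.
  - by rewrite lee_fin supdist_ge0.
  - by apply: sume_ge0 => l _; rewrite adde_ge0// lee_fin.
  under eq_bigr do rewrite -EFinM -EFinD.
  rewrite sumEFin lee_fin; apply: supdist_le => [|k].
    by apply: sumr_ge0 => l _; rewrite addr_ge0// mulr_ge0.
  rewrite !tnth_mktuple -sumrB; apply: (le_trans (ler_norm_sum _ _ _)).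
  apply: ler_sum => l _.
  have hb : `|tnth (a l) k| <= b l.
    by have := ler_tnth_supdist (a l) (nseq_tuple d 0) k; rewrite tnth_nseq subr0.
  have hc : `|tnth (a l) k - tnth (a' l) k| <= c l by exact: ler_tnth_supdist.
  rewrite indicE; case: ifPn => h1; case: ifPn => h2.
  - apply: (le_trans hc); rewrite lerDr mulr_ge0//.
  - by exfalso; move: h2; rewrite (le_trans (tle l) h1).
  - rewrite mem_set/=; last by rewrite /J /= in_itv/= h2 ltNge.
    rewrite mulr1 sub0r normrN.
    rewrite (_ : tnth (a' l) k = tnth (a l) k - (tnth (a l) k - tnth (a' l) k)); last by ring.
    by apply: (le_trans (ler_normB _ _)); exact: lerD.
  - by rewrite subr0 normr0 addr_ge0// mulr_ge0.
rewrite ge0_integral_sum//; last 2 first.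
- by move=> l; apply: emeasurable_funD; [exact: mE|exact: measurable_cst].
- by move=> l t _; rewrite adde_ge0// lee_fin.
rewrite -sumEFin; apply: lee_sum => l _.
rewrite (_ : integral _ _ _ = (\int[lebesgue_measure]_(t in `[0%R, 1%R[)
    ((b l)%:E * (\1_(J l) t)%:E) +
    \int[lebesgue_measure]_(t in `[0%R, 1%R[) (cst (c l)%:E t))%E); last first.
  apply: ge0_integralD => [//|t _||t _|]; [exact: bj0|exact: mE| |].
    by rewrite lee_fin.
  exact: measurable_cst.
rewrite EFinD; apply: leeD; last first.
  rewrite (_ : integral _ _ _ =
    (c l)%:E * lebesgue_measure (`[0%R, 1%R[%classic : set R))%E; last exact: integral_cst.
  by rewrite lebesgue_measure_itv/= lte_fin ltr01 -EFinB subr0 mule1.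
apply: (@le_trans _ _ ((b l)%:E * lebesgue_measure (J l))%E).
  rewrite (_ : integral _ _ _ = ((b l)%:E *
    \int[lebesgue_measure]_(t in `[0%R, 1%R[) (\1_(J l) t)%:E)%E); last first.
    apply: ge0_integralZl => [//||t _|]; rewrite ?lee_fin//.
    apply: measurable_funTS; apply/measurable_EFinP; apply: measurable_indic.
    exact: mJ.
  apply: lee_wpmul2l; first by rewrite lee_fin.
  rewrite (_ : lebesgue_measure (J l) =
    (\int[lebesgue_measure]_t (\1_(J l) t)%:E)%E); last first.
    by rewrite integral_indic ?setIT//; exact: mJ.
  by apply: le_integral_subset => [t _ //|t _|t _|t _ //]; rewrite lee_fin.
rewrite EFinM; apply: lee_wpmul2l; first by rewrite lee_fin.
rewrite lebesgue_measure_itv/= lte_fin -EFinB; case: ifP => _ //.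
by rewrite lee_fin subr_ge0.
Qed.

End step_paths.

Lemma powRD_le {R : realType} (x y s : R) : 0 < s -> 0 <= x -> 0 <= y ->
  (x + y) `^ s <= 2 `^ s * (x `^ s + y `^ s).
Proof.
move=> s0 x0 y0.
have := @powR_sum_le R _ [:: true; false] (fun c => if c then x else y) s s0.
by rewrite !big_cons !big_nil !addr0; apply; case.
Qed.

Section path_coding.
Context {R : realType} {d : nat} {T : Type}.
Variables (lam s : R) (e : nat -> T -> R) (Z : nat -> T -> d.-tuple R).
Hypotheses (lam0 : 0 < lam) (s0 : 0 < s).

Lemma Xcp_step_path w m t : (forall k, 0 <= e k w) ->
  1 <= jump_time lam e m.+1 w -> 0 <= t < 1 ->
  Xcp lam e Z w t =
  step_path (fun l : 'I_m => jump_time lam e l.+1 w) (fun l => Z l w) t.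
Proof.
move=> e0 Tm /andP[t0 t1].
have [i [im h1 h2]] : exists i, [/\ (i <= m)%N, jump_time lam e i w <= t &
    t < jump_time lam e i.+1 w].
  have : t < jump_time lam e m.+1 w by lra.
  elim: m {Tm} => [|m ih] h; first by exists 0%N; rewrite jump_time0.
  have [hm|hm] := leP (jump_time lam e m.+1 w) t; first by exists m.+1.
  by have [i [im h1 h2]] := ih hm; exists i; split => //; exact: leqW.
rewrite (Xcp_jump_sum Z lam0 e0 h1 h2).
apply: eq_from_tnth => k; rewrite !tnth_mktuple.
rewrite (big_ord_widen m (fun l => tnth (Z l w) k) im) big_mkcond.
apply: eq_bigr => l _; case: ltnP => li.
  rewrite ifT//; apply: le_trans h1; exact: jump_time_nondecreasing.
rewrite ifF//; apply/negbTE; rewrite -ltNge; apply: (lt_le_trans h2).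
exact: jump_time_nondecreasing.
Qed.

Definition code_path (m K L : nat) (C : 'I_L -> d.-tuple R)
    (f : {ffun 'I_m -> 'I_K * 'I_L}) : R -> d.-tuple R :=
  step_path (fun l => (f l).1%:R / K%:R) (fun l => C (f l).2).

(** Round each jump time down to the grid of mesh [1 / K] and take for each jump a codeword that
    attains the minimum. Moving the power [s] inside the sums costs [m]^ s[over the jumps and]2
    [^ s] for the two errors of each jump. *)
Lemma code_path_approx w m K L (C : 'I_L -> d.-tuple R) :
  (forall k, 0 <= e k w) -> jump_time lam e m w < 1 -> 1 <= jump_time lam e m.+1 w ->
  (0 < K)%N -> (0 < L)%N ->
  exists f : {ffun 'I_m -> 'I_K * 'I_L},
  (poweR (rhoD (Xcp lam e Z w) (code_path C f)) s <=
   ((2 * m%:R) `^ s)%:E * \sum_(l < m)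
     (((supdist (Z l w) (nseq_tuple d 0) / K%:R) `^ s)%:E +
      \big[Order.min/+oo]_(i < L) poweR (supdist (Z l w) (C i))%:E s))%E.
Proof.
move=> e0 Tm TSm K0 L0; have K0' : 0 < K%:R :> R by rewrite ltr0n.
pose G (l : 'I_m) (i : 'I_L) : \bar R := poweR (supdist (Z l w) (C i))%:E s.
have [a ha] := choice (fun l : 'I_m => big_mine_attained (G l) L0).
pose tl (l : 'I_m) := jump_time lam e l.+1 w.
have tl1 l : 0 <= tl l < 1.
  rewrite jump_time_ge0//=; apply: le_lt_trans Tm; exact: jump_time_nondecreasing.
have Ktl l : 0 <= K%:R * tl l by rewrite mulr_ge0//; case/andP: (tl1 l).
have trK l : (Num.truncn (K%:R * tl l) < K)%N.
  rewrite truncn_lt_nat// -[ltRHS]mulr1 ltr_pM2l//; by case/andP: (tl1 l).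
pose f : {ffun 'I_m -> 'I_K * 'I_L} := [ffun l => (Ordinal (trK l), a l)].
exists f.
have -> : rhoD (Xcp lam e Z w) (code_path C f) =
    rhoD (step_path tl (fun l => Z l w)) (code_path C f).
  apply: eq_integral => t; rewrite inE /= in_itv/= => t01.
  by rewrite (Xcp_step_path e0 TSm t01).
have tle l : (f l).1%:R / K%:R <= tl l.
  rewrite ffunE /= ler_pdivrMr// [leRHS]mulrC.
  by have /truncn_itv/andP[] := Ktl l.
pose b (l : 'I_m) := supdist (Z l w) (nseq_tuple d 0) / K%:R.
pose c (l : 'I_m) := supdist (Z l w) (C (a l)).
have b0 l : 0 <= b l by rewrite divr_ge0// supdist_ge0.
have c0 l : 0 <= c l by exact: supdist_ge0.
have rho_le : (rhoD (step_path tl (fun l => Z l w)) (code_path C f) <=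
    (\sum_(l < m) (b l + c l))%:E)%E.
  apply: (le_trans (rhoD_step_path _ _ tle)); rewrite lee_fin; apply: ler_sum => l _.
  apply: lerD; last by rewrite ffunE.
  rewrite ler_wpM2l ?supdist_ge0// lerBlDr ffunE /=.
  rewrite -[X in X + _]mul1r -mulrDl nat1r ler_pdivlMr// [leLHS]mulrC.
  by have /truncn_itv/andP[_ /ltW] := Ktl l.
apply: (@le_trans _ _ (((\sum_(l < m) (b l + c l)) `^ s)%:E)%E).
  rewrite -poweR_EFin; apply: gt0_ler_poweR => //; first exact: ltW.
  - by rewrite in_itv/= rhoD_ge0 leey.
  - rewrite in_itv/= leey andbT lee_fin sumr_ge0// => l _.
    by rewrite addr_ge0.
have -> : (\sum_(l < m) (((supdist (Z l w) (nseq_tuple d 0) / K%:R) `^ s)%:E +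
      \big[Order.min/+oo]_(i < L) poweR (supdist (Z l w) (C i))%:E s))%E =
    (\sum_(l < m) (b l `^ s + c l `^ s))%:E.
  by rewrite -sumEFin; apply: eq_bigr => l _; rewrite EFinD ha.
rewrite -EFinM lee_fin.
have bc0 l : 0 <= b l + c l by rewrite addr_ge0.
have sz : size (index_enum 'I_m) = m by rewrite -sum1_size sum1_card card_ord.
apply: (le_trans (powR_sum_le _ s0 bc0)); rewrite sz.
rewrite powRM// [2 `^ s * _]mulrC -mulrA ler_wpM2l ?powR_ge0// mulr_sumr.
by apply: ler_sum => l _; exact: powRD_le.
Qed.

End path_coding.

Section coding_bound.
Context {R : realType} {d : nat} {dT : measure_display} {T : measurableType dT}.
Variables (P : probability T R) (lam s : R).
Variables (e : nat -> T -> R) (Z : nat -> T -> d.-tuple R).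
Hypotheses (lam0 : 0 < lam) (s0 : 0 < s).
Hypothesis me : forall j, measurable_fun setT (e j).
Hypothesis law_e : forall j (A : set R), measurable A ->
  P (e j @^-1` A) = exponential_prob 1 A.
Hypothesis mZ : forall i, measurable_fun setT (Z i).
Hypothesis law_Z : forall i (A : set (d.-tuple R)), measurable A ->
  P (Z i @^-1` A) = P (Z 0%N @^-1` A).
Hypothesis ind : indep_eZ P e Z.

(** Some step is negative, or all jump times stay at or below time 1. *)
Definition exceptional : set T :=
  ~` nonneg_steps e `|` \bigcap_m many_jumps lam e m.

Lemma measurable_exceptional : measurable exceptional.
Proof.
apply: measurableU.
  by apply: measurableC; exact: measurable_nonneg_steps.
by apply: bigcapT_measurable => m; exact: measurable_many_jumps.
Qed.

Lemma prob_exceptional : P exceptional = 0%E.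
Proof.
have mI : measurable (\bigcap_m many_jumps lam e m).
  by apply: bigcapT_measurable => m; exact: measurable_many_jumps.
have mN : measurable (~` nonneg_steps e).
  by apply: measurableC; exact: measurable_nonneg_steps.
apply/eqP; rewrite eq_le measure_ge0 andbT.
apply: (le_trans (measureU2 P mN mI)).
rewrite (_ : (0 = 0 + 0)%E); last by rewrite adde0.
have nn0 : (P (~` nonneg_steps e) <= 0)%E by rewrite (prob_nonneg_stepsC me law_e).
apply: leeD; first exact: nn0.
apply/lee_addgt0Pr => eps eps0; rewrite add0e.
(* [8 * lam] makes the tail bound at most [2 ^ (- M)], and [eps^-1] makes this at most [eps]. *)
have [M [M0 hM _]] := @nat_ceil R (8 * lam + eps^-1)
  (ltac:(by rewrite addr_ge0 ?mulr_ge0 ?invr_ge0 ?(ltW lam0) ?(ltW eps0))).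
case: M M0 hM => // m _ hM.
have M1 : 0 < m.+1%:R :> R by rewrite ltr0n.
have i0 : 0 < eps^-1 by rewrite invr_gt0.
have l0 := lam0.
apply: (@le_trans _ _ (P (many_jumps lam e m.+1 `&` Z 0%N @^-1` setT))).
  apply: le_measure; rewrite ?inE//.
    by rewrite preimage_setT setIT; exact: measurable_many_jumps.
  by move=> w h; split => //; exact: h.
apply: (le_trans (prob_many_jumps lam0 me law_e mZ law_Z ind _ _ measurableT)).
rewrite preimage_setT probability_setT mule1 lee_fin.
apply: (@le_trans _ _ (2^-1 ^+ m.+1)).
  rewrite lerXn2r ?nnegrE ?divr_ge0 ?mulr_ge0 ?(ltW lam0)//.
  by rewrite ler_pdivrMr//; lra.
rewrite exprVn -[leRHS]invrK lef_pV2 ?posrE ?exprn_gt0//.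
apply: (@le_trans _ _ m.+1%:R); first by lra.
by rewrite -natrX ler_nat ltnW// ltn_expl.
Qed.

Definition jump_cost (K L : nat) (C : 'I_L -> d.-tuple R) (z : d.-tuple R) : \bar R :=
  (((supdist z (nseq_tuple d 0) / K%:R) `^ s)%:E +
    \big[Order.min/+oo]_(i < L) poweR (supdist z (C i))%:E s)%E.

Lemma jump_cost_ge0 K L (C : 'I_L -> d.-tuple R) z : (0 <= jump_cost K C z)%E.
Proof.
rewrite adde_ge0 ?lee_fin ?powR_ge0//.
by apply: big_mine_ge => i; exact: poweR_ge0.
Qed.

Lemma measurable_min_cost L (C : 'I_L -> d.-tuple R) : measurable_fun setT
  (fun z => \big[Order.min/+oo]_(i < L) poweR (supdist z (C i))%:E s)%E.
Proof.
elim: (index_enum 'I_L) => [|i r ih].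
  by under eq_fun do rewrite big_nil; exact: measurable_cst.
under eq_fun do rewrite big_cons; apply: measurable_mine => //.
apply: (measurableT_comp (measurable_poweR s)).
by apply/measurable_EFinP; exact: measurable_supdistr.
Qed.

Lemma measurable_supdist_powR (y : d.-tuple R) (k : R) :
  measurable_fun setT (fun z => ((supdist z y / k) `^ s)%:E).
Proof.
apply/measurable_EFinP; apply: (measurableT_comp (measurable_powR s)).
apply: measurable_funM; last exact: measurable_cst.
exact: measurable_supdistr.
Qed.

Lemma measurable_jump_cost K L (C : 'I_L -> d.-tuple R) :
  measurable_fun setT (jump_cost K C).
Proof.
apply: emeasurable_funD; first exact: measurable_supdist_powR.
exact: measurable_min_cost.
Qed.

Section codebook.
Variables (n : nat) (K L : nat -> nat) (C : forall m, 'I_(L m) -> d.-tuple R).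
Hypotheses (K0 : forall m, (0 < K m)%N) (L0 : forall m, (0 < L m)%N).

Definition code_index := {m : 'I_n.+1 & {ffun 'I_m -> 'I_(K m) * 'I_(L m)}}.

Definition codeword (i : 'I_#|{: code_index}|) : R -> d.-tuple R :=
  code_path (@C (tag (enum_val i))) (tagged (enum_val i)).

Lemma card_code_index :
  #|{: code_index}| = (\sum_(m < n.+1) (K m * L m) ^ m)%N.
Proof.
rewrite card_tagged sumnE big_map big_enum/=.
by apply: eq_bigr => m _; rewrite card_ffun card_prod !card_ord.
Qed.

(** Beyond [n] jumps the path is coded by zero. Writing this as a codebook with the single jump 0 on
    a grid of mesh 1 gives all levels the same form. *)
Definition level_cost (m : nat) : d.-tuple R -> \bar R :=
  if (m <= n)%N then jump_cost (K m) (@C m)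
  else jump_cost 1 (fun _ : 'I_1 => nseq_tuple d 0).

Lemma level_cost_ge0 m z : (0 <= level_cost m z)%E.
Proof. by rewrite /level_cost; case: ifP => _; exact: jump_cost_ge0. Qed.

Lemma measurable_level_cost m : measurable_fun setT (level_cost m).
Proof. by rewrite /level_cost; case: ifP => _; exact: measurable_jump_cost. Qed.

Let path_cost (m : nat) (w : T) : \bar R :=
  (((2 * m%:R) `^ s)%:E * \sum_(l < m) level_cost m (Z l w))%E.

Let path_cost_ge0 m w : (0 <= path_cost m w)%E.
Proof.
rewrite mule_ge0 ?lee_fin ?powR_ge0// sume_ge0// => l _; exact: level_cost_ge0.
Qed.

Let codebook_cost (w : T) : \bar R :=
  \big[Order.min/+oo%E]_i poweR (rhoD (Xcp lam e Z w) (codeword i)) s.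

(** Here [m + 1] is the first index whose jump time is at least 1, so the path on [[0, 1[] is given
    by its first [m] jumps. *)
Lemma codebook_cost_le w : ~ exceptional w ->
  exists m, many_jumps lam e m w /\ (codebook_cost w <= path_cost m w)%E.
Proof.
move=> /not_orP[/contrapT nn /existsNP[M /not_implyP[_ nM]]].
have ex : exists m, 1 <= jump_time lam e m w.
  exists M; rewrite /jump_time ler_pdivlMr// mul1r ltW// ltNge.
  by apply/negP => h; apply: nM.
have [[|m] Tm mmin] := ex_minnP ex; first by move: Tm; rewrite jump_time0 ler10.
have Tm1 : jump_time lam e m w < 1.
  by rewrite ltNge; apply/negP => /mmin; rewrite ltnn.
exists m; split.
  by split => //=; move: Tm1; rewrite /jump_time ltr_pdivrMr// mul1r => /ltW.
have min_le i : (codebook_cost w <= poweR (rhoD (Xcp lam e Z w) (codeword i)) s)%E.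
  exact: bigmin_le_cond.
rewrite /path_cost /level_cost; case: leqP => mn.
  have [f hf] := code_path_approx Z lam0 s0 (@C m) nn Tm1 Tm (K0 m) (L0 m).
  pose x : code_index := existT _ (Ordinal (mn : (m < n.+1)%N)) f.
  apply: (le_trans (min_le (enum_rank x))).
  by rewrite /codeword enum_rankK.
have [f hf] := code_path_approx Z lam0 s0 (fun _ : 'I_1 => nseq_tuple d 0) nn Tm1 Tm (ltnSn 0) (ltnSn 0).
(* The code path without jumps is the zero path, and so is every path assembled from zero jumps. *)
pose x : code_index := existT _ ord0 [ffun l : 'I_0 => match notF (ltn_ord l) with end].
apply: (le_trans (min_le (enum_rank x))); apply: le_trans hf.
rewrite /codeword enum_rankK /= /code_path.
rewrite (_ : step_path _ _ = step_path (fun l => (f l).1%:R / 1%:R)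
  (fun l => nseq_tuple d 0))//.
apply/funext => t; apply: eq_from_tnth => k; rewrite !tnth_mktuple big_ord0.
by rewrite big1// => l _; rewrite tnth_nseq if_same.
Qed.

Let measurable_level_Z m l : measurable_fun setT (fun w => level_cost m (Z l w)).
Proof. by apply: measurableT_comp; [exact: measurable_level_cost|exact: mZ]. Qed.

Let measurable_path_cost m : measurable_fun setT (path_cost m).
Proof.
apply: emeasurable_funM; first exact: measurable_cst.
exact: emeasurable_sum.
Qed.

(** On [many_jumps] each [Z l] has law at most [(4 lam / m) ^ m] times that of [Z 0]; the [m] jumps
    give the further factor [m]. *)
Lemma path_cost_integral m :
  (\int[P]_(w in many_jumps lam e m) path_cost m w <=
   ((2 * m%:R) `^ s * (m%:R * (4 * lam / m%:R) ^+ m))%:E *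
     \int[P]_w level_cost m (Z 0%N w))%E.
Proof.
case: m => [|m].
  rewrite integral0_eq => [|w _]; last by rewrite /path_cost big_ord0 mule0.
  by rewrite mulr0 powR0 ?gt_eqF// mul0r mul0e.
have mE := measurable_many_jumps lam me m.+1.
set q : R := (4 * lam / m.+1%:R) ^+ m.+1.
have q0 : 0 <= q by rewrite exprn_ge0// divr_ge0// mulr_ge0// ltW.
have key l : (\int[P]_(w in many_jumps lam e m.+1) level_cost m.+1 (Z l w) <=
    q%:E * \int[P]_w level_cost m.+1 (Z 0%N w))%E.
  apply: integral_event_le => //.
  - by move=> B mB; exact: (prob_many_jumps lam0 me law_e mZ law_Z ind).
  - exact: measurable_level_cost.
  - exact: level_cost_ge0.
rewrite (_ : integral _ _ _ = ((2 * m.+1%:R) `^ s)%:E *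
    \sum_(l < m.+1) \int[P]_(w in many_jumps lam e m.+1) level_cost m.+1 (Z l w))%E.
  rewrite EFinM -muleA; apply: lee_wpmul2l; first by rewrite lee_fin powR_ge0.
  apply: (@le_trans _ _ (\sum_(l < m.+1) (q%:E * \int[P]_w level_cost m.+1 (Z 0%N w)))%E).
    by apply: lee_sum => l _; exact: key.
  rewrite big_const_ord EFinM -muleA.
  set x := (q%:E * _)%E; elim: (m.+1) => [|p ih] /=; first by rewrite mul0e.
  rewrite -natr1 EFinD ge0_muleDl ?lee_fin// addeC mul1e.
  exact: leeD.
rewrite ge0_integralZl_EFin ?powR_ge0//.
- congr (_ * _)%E; rewrite ge0_integral_sum// => [l|l w _].
  + by apply: measurable_funTS; exact: measurable_level_Z.
  + exact: level_cost_ge0.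
- by move=> w _; apply: sume_ge0 => l _; exact: level_cost_ge0.
- by apply: measurable_funTS; exact: emeasurable_sum.
Qed.

Lemma codebook_integral_le :
  (\int[P]_w codebook_cost w <= \sum_(0 <= m <oo)
    ((2 * m%:R) `^ s * (m%:R * (4 * lam / m%:R) ^+ m))%:E *
     \int[P]_w level_cost m (Z 0%N w))%E.
Proof.
pose V m := path_cost m \_ (many_jumps lam e m).
have V0 m w : (0 <= V m w)%E by rewrite /V patchE; case: ifP.
have mV m : measurable_fun setT (V m).
  apply/(measurable_restrictT _ (measurable_many_jumps lam me m)).
  exact: measurable_funTS.
have mN := measurable_exceptional.
have mi : measurable_fun setT (fun w => (\1_exceptional w)%:E : \bar R).
  by apply/measurable_EFinP; exact: measurable_indic.
have sV0 w : (0 <= \sum_(0 <= m <oo) V m w)%E by exact: nneseries_ge0.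
have i0 w : (0 <= +oo * (\1_exceptional w)%:E :> \bar R)%E by rewrite mule_ge0// lee_fin.
(* The events [many_jumps] overlap, so the series overcounts, as an upper bound may. The infinite
   term dominates the cost on the exceptional set and integrates to 0. *)
apply: (@le_trans _ _ (\int[P]_w
    (\sum_(0 <= m <oo) V m w + +oo * (\1_exceptional w)%:E))%E).
  apply: le_integral_subset => // w _.
  - by apply: big_mine_ge => i; exact: poweR_ge0.
  - exact: adde_ge0.
  have [ew|ew] := pselect (exceptional w).
    rewrite indicE mem_set// mule1 addey ?leey//.
    by rewrite -ltNye; apply: lt_le_trans (sV0 w).
  rewrite indicE memNset// mule0 adde0.
  have [m [mw h]] := codebook_cost_le ew; apply: (le_trans h).
  apply: (le_trans _ (nneseries_lim_ge m.+1 _)) => //.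
  rewrite big_nat_recr//= [V m w]patchE (mem_set mw) leeDr// sume_ge0//.
rewrite ge0_integralD//; last 2 first.
- by apply: ge0_emeasurable_sum => m; [move=> w _ _; exact: V0|move=> _; exact: mV].
- by apply: emeasurable_funM => //; exact: measurable_cst.
rewrite [X in (_ + X)%E](_ : _ = 0%E); last first.
  rewrite ge0_integralZl// integral_indic// setIT.
  by transitivity (+oo * P exceptional)%E => //; rewrite prob_exceptional mule0.
rewrite adde0 integral_nneseries//; apply: lee_nneseries => [m _ _|m _].
  exact: integral_ge0.
by rewrite -integral_mkcond; exact: path_cost_integral.
Qed.

End codebook.
End coding_bound.

(** * Rate of the coding scheme *)

Lemma weighted_amgm {R : realType} (m p q t : R) : 0 < m -> 0 < p ->
  t ^+ 2 <= 4 * p * q -> t <= m * p + q / m.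
Proof.
move=> m0 p0 h; rewrite -subr_ge0.
have -> : m * p + q / m - t =
    ((2 * p * m - t) ^+ 2 + (4 * p * q - t ^+ 2)) / (4 * p * m).
  by field; rewrite !gt_eqF.
apply: divr_ge0; last by rewrite !mulr_ge0// ltW.
by apply: addr_ge0; [exact: sqr_ge0|rewrite subr_ge0].
Qed.

(** Three regimes. For [m > u] the improbability [m ln m] alone suffices; for [m <= u / (A0 v)] the
    fine resolution alone does; in between [ln m] is close to [ln u = v ^+ 2 / 2], and
    [weighted_amgm] gives the optimum. [B] absorbs the constants per jump. *)
Lemma coding_exponent {R : realType} (s D1 B dl b : R) :
  0 < s -> 1 <= D1 -> 0 <= B -> 0 < dl -> dl < 1 -> 0 < b -> b ^+ 2 = 2 * s / D1 ->
  exists2 A : R, 1 <= A & forall u v m : R, A <= v -> 1 <= u -> ln u = v ^+ 2 / 2 ->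
    1 <= m ->
    (u < m -> b * u * v <= m * (ln m - B)) /\
    (m <= u -> (1 - dl) * (b * u * v) <=
      m * (ln m - B) + s * ((1 - dl / 3) * u ^+ 2 / (m * (D1 + dl / 3)))).
Proof.
move=> s0 D1_ge1 B0 dl0 dl1 b0 bE.
pose d0 := dl / 3; have d00 : 0 < d0 by rewrite divr_gt0.
have d01 : d0 < 1 by rewrite /d0; lra.
pose D' := D1 + d0; have D'0 : 0 < D' by rewrite /D'; lra.
have e0 : 0 < 1 - d0 by lra.
pose A0 := D' * (b + B) / (s * (1 - d0)).
have A00 : 0 < A0 by rewrite divr_gt0 ?mulr_gt0//; lra.
pose A1 := 2 * (A0 + B) / d0.
have A10 : 0 <= A1 by rewrite divr_ge0 ?mulr_ge0 ?(ltW d00)//; lra.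
exists (1 + 2 * b + 2 * B + A1); first by lra.
move=> u v m Av u1 lu m1.
have [u0 m0] : 0 < u /\ 0 < m by split; lra.
have v1 : 1 <= v by lra.
have v0 : 0 < v by lra.
have lm0 : 0 <= ln m by rewrite ln_ge0.
split => [um|mu].
  have lm : v ^+ 2 / 2 <= ln m by rewrite -lu ler_ln ?posrE// ltW.
  have h : b * v <= v ^+ 2 / 2 - B.
    have : (2 * b + 2 * B) * v <= v ^+ 2 by rewrite expr2 ler_wpM2r//; lra.
    have : B <= B * v by rewrite ler_peMr.
    lra.
  rewrite (_ : b * u * v = u * (b * v)); last by ring.
  apply: ler_pM; [lra|by rewrite mulr_ge0// ltW|lra|lra].
have [small|large] := leP m (u / (A0 * v)).
  have key : (b + B) * (u * v) <= s * ((1 - d0) * u ^+ 2 / (m * D')).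
    have -> : s * ((1 - d0) * u ^+ 2 / (m * D')) =
        (s * (1 - d0) / D') * (u ^+ 2 / m) by field; rewrite !gt_eqF.
    have -> : (b + B) * (u * v) = (s * (1 - d0) / D') * (u * (A0 * v)).
      by rewrite /A0; field; rewrite !gt_eqF.
    rewrite ler_pM2l ?divr_gt0 ?mulr_gt0// ler_pdivlMr// expr2.
    rewrite (_ : u * (A0 * v) * m = u * (m * (A0 * v))); last by ring.
    by rewrite ler_pM2l//; move: small; rewrite (ler_pdivlMr _ _ (mulr_gt0 A00 v0)).
  have h1 : - (B * (u * v)) <= m * (ln m - B).
    have : m * B <= u * v * B by rewrite ler_wpM2r// (le_trans mu)// ler_peMr// ltW.
    by have := mulr_ge0 (ltW m0) lm0; lra.
  have := mulr_ge0 (ltW dl0) (ltW (mulr_gt0 b0 (mulr_gt0 u0 v0))).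
  rewrite -/d0 -/D'; lra.
have lnm : (1 - d0) * v ^+ 2 / 2 <= ln m - B.
  have Av0 : 0 < A0 * v by rewrite mulr_gt0.
  have h1 : ln u - ln (A0 * v) <= ln m.
    by rewrite -ln_div ?posrE// ler_ln ?posrE ?divr_gt0// ltW.
  have h2 : ln (A0 * v) <= A0 * v by rewrite ltW// ln_sublinear.
  have h3 : A0 * v + B <= d0 * v ^+ 2 / 2.
    apply: (@le_trans _ _ ((A0 + B) * v)).
      by rewrite mulrDl lerD2l ler_peMr.
    rewrite (_ : d0 * v ^+ 2 / 2 = d0 / 2 * v * v); last by ring.
    rewrite ler_wpM2r ?(ltW v0)//.
    rewrite (_ : A0 + B = d0 / 2 * A1); last by rewrite /A1; field; rewrite gt_eqF.
    by rewrite ler_pM2l ?divr_gt0//; lra.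
  move: h1; rewrite lu; lra.
rewrite -/d0 -/D'.
apply: (@le_trans _ _ (m * ((1 - d0) * v ^+ 2 / 2) + s * (1 - d0) * u ^+ 2 / D' / m)).
  apply: weighted_amgm => //.
    by rewrite divr_gt0// mulr_gt0// exprn_gt0.
  have -> : 4 * ((1 - d0) * v ^+ 2 / 2) * (s * (1 - d0) * u ^+ 2 / D') =
      (2 * s * (u * v) ^+ 2) * ((1 - d0) ^+ 2 / D') by field; rewrite gt_eqF.
  have -> : ((1 - dl) * (b * u * v)) ^+ 2 =
      (2 * s * (u * v) ^+ 2) * ((1 - dl) ^+ 2 / D1).
    rewrite (_ : ((1 - dl) * (b * u * v)) ^+ 2 =
        b ^+ 2 * ((1 - dl) * (u * v)) ^+ 2); last by ring.
    by rewrite bE; field; rewrite gt_eqF//; lra.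
  apply: ler_wpM2l.
    by apply: mulr_ge0; [rewrite mulr_ge0// ltW|exact: sqr_ge0].
  have D10 : 0 < D1 by lra.
  rewrite ler_pdivrMr// mulrAC ler_pdivlMr//.
  apply: (@le_trans _ _ ((1 - dl) ^+ 2 * ((1 + d0) * D1))).
    by rewrite ler_wpM2l ?sqr_ge0// /D'; nra.
  rewrite mulrA ler_pM2r//.
  (* Of the loss [dl], one third is spent on the number of codewords, one on the effective dimension
     [D'], and one on replacing [ln m] by [ln u]. *)
  have dE : dl = 3 * d0 by rewrite /d0; field.
  rewrite dE; rewrite dE in dl1; nra.
apply: lerD; first by rewrite ler_pM2l.
by rewrite le_eqVlt; apply/orP; left; apply/eqP; field; rewrite !gt_eqF.
Qed.

(** * Codebooks of the jump law *)

Section jump_quantization.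
Context {R : realType} {d : nat} {dT : measure_display} {T : measurableType dT}.
Variables (P : probability T R) (Y : T -> d.-tuple R) (s : R).
Hypotheses (s0 : 0 < s) (mY : measurable_fun setT Y).

Definition quantization_cost (L : nat) (C : 'I_L -> d.-tuple R) : \bar R :=
  (\int[P]_w \big[Order.min/+oo]_(i < L) poweR (supdist (Y w) (C i))%:E s)%E.

Lemma quantization_cost_ge0 L (C : 'I_L -> d.-tuple R) : (0 <= quantization_cost C)%E.
Proof.
by apply: integral_ge0 => w _; apply: big_mine_ge => i; exact: poweR_ge0.
Qed.

Lemma dq_codebook (eps k : R) : 0 < eps -> (dq P Y s eps < (expR k)%:E)%E ->
  exists L (C : 'I_L -> d.-tuple R), [/\ (0 < L)%N, L%:R <= expR k &
    (quantization_cost C <= ((2 * eps) `^ s)%:E)%E].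
Proof.
move=> eps0 /ereal_inf_lt[_ [n [n1 Dn] <-] nk].
(* The infimum defining [Dq] need not be attained; the factor 2 leaves room for an actual
   codebook. *)
have : (Dq P Y (fun x y => (supdist x y)%:E) setT s (ln n%:R) < (2 * eps)%:E)%E.
  by apply: (le_lt_trans Dn); rewrite lte_fin; lra.
move=> /ereal_inf_lt[_ [[L C] /= [L1 [_ lnL]] <-] costlt].
exists L, C; split => //.
  rewrite lte_fin in nk; apply: (le_trans _ (ltW nk)).
  by move: lnL; rewrite ler_ln// posrE ltr0n.
have -> : quantization_cost C = poweR (poweR (quantization_cost C) s^-1) s.
  by rewrite -poweRrM mulVf ?gt_eqF// poweRe1// quantization_cost_ge0.
rewrite -poweR_EFin.
apply: gt0_ler_poweR; first exact: ltW.
- by rewrite in_itv/= poweR_ge0 leey.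
- by rewrite in_itv/= leey andbT lee_fin mulr_ge0// ltW.
- exact: ltW.
Qed.

(** The norm of [Y w] is at most its distance to a nearest codeword plus [a], the sum of the norms
    of all codewords. Finiteness of the moment of order [s] is thus a consequence of the limsup
    condition. *)
Lemma moment_lty L (C : 'I_L -> d.-tuple R) : (0 < L)%N ->
  (quantization_cost C < +oo)%E ->
  (\int[P]_w ((supdist (Y w) (nseq_tuple d 0)) `^ s)%:E < +oo)%E.
Proof.
move=> L0 fin.
pose a : R := \sum_(i < L) supdist (C i) (nseq_tuple d 0).
have a0 : 0 <= a by apply: sumr_ge0 => i _; exact: supdist_ge0.
have mC : measurable_fun setT
    (fun w => \big[Order.min/+oo]_(i < L) poweR (supdist (Y w) (C i))%:E s)%E.
  by apply: (measurableT_comp (measurable_min_cost s C)).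
apply: (@le_lt_trans _ _ (\int[P]_w ((2 `^ s)%:E *
   (\big[Order.min/+oo]_(i < L) poweR (supdist (Y w) (C i))%:E s + (a `^ s)%:E)))%E).
  have m0 w : (0 <= \big[Order.min/+oo]_(i < L) poweR (supdist (Y w) (C i))%:E s)%E.
    by apply: big_mine_ge => i; exact: poweR_ge0.
  apply: le_integral_subset => // w _.
  - by rewrite lee_fin powR_ge0.
  - by rewrite mule_ge0 ?adde_ge0 ?lee_fin ?powR_ge0.
  have [i ->] := big_mine_attained (fun i => poweR (supdist (Y w) (C i))%:E s) L0.
  rewrite poweR_EFin -EFinD -EFinM lee_fin.
  apply: le_trans (powRD_le _ _ _) => //; last exact: supdist_ge0.
  apply: ge0_ler_powR; rewrite ?nnegrE ?addr_ge0 ?supdist_ge0 ?(ltW s0)//.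
  apply: (le_trans (supdist_triangle (C i) _ _)); rewrite lerD2l.
  rewrite /a (bigD1 i)//= lerDl sumr_ge0// => j _; exact: supdist_ge0.
have m0 w : (0 <= \big[Order.min/+oo]_(i < L) poweR (supdist (Y w) (C i))%:E s)%E.
  by apply: big_mine_ge => i; exact: poweR_ge0.
rewrite ge0_integralZl_EFin ?powR_ge0//; last 2 first.
- by move=> w _; rewrite adde_ge0// lee_fin powR_ge0.
- by apply: emeasurable_funD => //; exact: measurable_cst.
rewrite ge0_integralD//; last by move=> w _; rewrite lee_fin powR_ge0.
rewrite lte_mul_pinfty ?lee_fin ?powR_ge0// lte_add_pinfty//.
rewrite (_ : integral _ _ _ = (a `^ s)%:E * P setT)%E; last exact: integral_cst.
by rewrite probability_setT mule1 ltry.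
Qed.

Lemma dq_limsup_codebooks (k dl : R) : 0 <= k -> 0 < dl ->
  limf_esup (fun eps : R => lne (dq P Y s eps) * ((ln eps^-1)^-1)%:E)%E (0%R)^'+
    = k%:E ->
  exists2 eps0 : R, 0 < eps0 < 1 & forall eps, 0 < eps < eps0 ->
  exists L (C : 'I_L -> d.-tuple R), [/\ (0 < L)%N, L%:R <= expR ((k + dl) * ln eps^-1) &
    (quantization_cost C <= ((2 * eps) `^ s)%:E)%E].
Proof.
move=> k0 dl0 lim.
have : (0%R)^'+ [set eps : R | lne (dq P Y s eps) * ((ln eps^-1)^-1)%:E < (k + dl)%:E]%E.
  apply: limf_esup_lt => [A B AB FA|]; first by apply: filterS FA.
  by rewrite [ltLHS]lim lte_fin ltrDl.
move=> [dl1 /= dl10 H].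
(* Below [2^-1] the denominator [ln eps^-1] is positive. *)
exists (Num.min dl1 2^-1).
  by rewrite lt_min dl10 invr_gt0 ltr0n/= gt_min invf_lt1 ?ltr1n ?orbT.
move=> eps /andP[eps0]; rewrite lt_min => /andP[e1 e2].
have le0 : 0 < ln eps^-1.
  by rewrite ln_gt0// invf_gt1//; lra.
apply: dq_codebook => //.
have dq0 : (0 <= dq P Y s eps)%E.
  by apply: le_ereal_inf_tmp => _ [n _ <-]; rewrite lee_fin.
have : (lne (dq P Y s eps) * ((ln eps^-1)^-1)%:E < (k + dl)%:E)%E.
  by apply: H => //=; rewrite sub0r normrN gtr0_norm.
rewrite lte_pdivrMr// -EFinM => h.
rewrite -lte_lne; first by rewrite lne_EFin ?expR_gt0// expRK.
  by rewrite in_itv/= dq0 leey.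
by rewrite in_itv/= leey andbT lee_fin expR_ge0.
Qed.

End jump_quantization.

(** Gathers the part of the exponent of level [m] that is at most linear in [m]; it becomes the
    constant [B] of [coding_exponent]. The term [(N + 1) * l2] is the logarithm of [2 ^ m.+1], the
    price of summing over the levels. *)
Lemma coding_constant {R : realType} (s N l l2 l4 lA : R) :
  0 < s -> 1 <= N -> l <= N -> 0 <= l2 -> l2 <= 1 -> 0 <= lA ->
  s * (l2 + l) + l + N * l4 + s * l2 + lA + (N + 1) * l2 <=
  N * (3 * s + 3 + `|l4| + lA).
Proof.
move=> s0 N1 lN l20 l21 lA0.
have N0 : 0 <= N by lra.
have h4 : N * l4 <= N * `|l4| by rewrite ler_wpM2l// ler_norm.
have h1 : s * l <= s * N by rewrite ler_wpM2l// ltW.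
have h2 : s * l2 <= s * N by rewrite ler_wpM2l ?(ltW s0)//; lra.
have h3 : lA <= N * lA by rewrite ler_peMl.
have h5 : (N + 1) * l2 <= N + 1 by rewrite ler_piMr//; lra.
lra.
Qed.

Lemma level_weightE {R : realType} (s lam A x : R) (m : nat) :
  0 < lam -> 0 < A -> (0 < m)%N ->
  (2 * m%:R) `^ s * (m%:R * (4 * lam / m%:R) ^+ m) * ((2 * expR (- x)) `^ s * A) =
  expR (s * (ln 2 + ln m%:R) + ln m%:R + m%:R * (ln (4 * lam) - ln m%:R) +
        s * (ln 2 - x) + ln A).
Proof.
move=> l0 A0 m0; have m0' : 0 < m%:R :> R by rewrite ltr0n.
have t0 : 0 < 2 :> R by [].
rewrite !expRD -[in RHS](@lnM _ 2 m%:R) ?posrE// !lnK ?posrE//.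
rewrite expRM_natl expRB !lnK ?posrE ?mulr_gt0//.
rewrite /powR !gt_eqF ?mulr_gt0 ?expR_gt0//.
rewrite [ln (2 * expR _)]lnM ?posrE ?expR_gt0// expRK.
by ring.
Qed.

(** At resolution [eps m], a path with [m] jumps and [1 + d + dl / 3] effective parameters per jump
    takes [exp ((1 - dl / 3) r)] codewords; the spare factor [exp (dl r / 3)] pays for the [n + 1]
    levels, with [n] the integer part of [sqrt r]. *)
Lemma coding_terms {R : realType} (s lam A dl eps0 : R) (d : nat) :
  0 < s -> 0 < lam -> 1 <= A -> 0 < dl -> dl < 1 -> 0 < eps0 ->
  exists r0 : R, forall r, r0 <= r -> exists n : nat,
  let eps m := expR (- ((1 - dl / 3) * r / (m%:R * (1 + d%:R + dl / 3)))) in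
  let bound m := expR (- ((1 - dl) *
    (s * Num.sqrt (2 / (s * (1 + d%:R)) * r * ln r)))) / (2 ^ m.+1)%:R in
  [/\ 0 <= r, n.+1%:R * expR ((1 - dl / 3) * r) <= expR r,
      forall m, (0 < m <= n)%N -> eps m < eps0,
      forall m, (0 < m <= n)%N ->
        (2 * m%:R) `^ s * (m%:R * (4 * lam / m%:R) ^+ m) * ((2 * eps m) `^ s * A)
          <= bound m &
      forall m, (n < m)%N ->
        (2 * m%:R) `^ s * (m%:R * (4 * lam / m%:R) ^+ m) * A <= bound m].
Proof.
move=> s0 lam0 A1 dl0 dl1 eps00.
pose D1 : R := 1 + d%:R; have D1_ge1 : 1 <= D1 by rewrite lerDl.
have D0 : 0 < D1 by lra.
pose b := Num.sqrt (2 * s / D1).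
have b0 : 0 < b by rewrite sqrtr_gt0 divr_gt0// mulr_gt0.
have bE : b ^+ 2 = 2 * s / D1 by rewrite sqr_sqrtr// divr_ge0 ?mulr_ge0// ltW.
pose l2 : R := ln 2; have l20 : 0 < l2 by rewrite ln_gt0// ltr1n.
have l21 : l2 <= 1 by have := @le_ln1Dx R 1; rewrite /l2 (_ : 1 + 1 = 2)//; apply; lra.
pose l4 := ln (4 * lam); pose lA := ln A.
have lA0 : 0 <= lA by rewrite ln_ge0.
pose B := 3 * s + 3 + `|l4| + lA.
have B0 : 0 <= B by have := normr_ge0 l4; rewrite /B; lra.
have [A2 A2_ge1 main] := coding_exponent s0 D1_ge1 B0 dl0 dl1 b0 bE.
pose d0 := dl / 3; have d00 : 0 < d0 by rewrite divr_gt0.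
have d01 : 0 < 1 - d0 by rewrite /d0; lra.
pose D' := D1 + d0; have D'0 : 0 < D' by rewrite /D'; lra.
pose A3 := (`|ln eps0| + 1) * D' / (1 - d0).
have A30 : 0 <= A3 by rewrite divr_ge0 ?(ltW d01)// mulr_ge0 ?(ltW D'0)// addr_ge0.
have i0 : 0 <= d0^-1 by rewrite invr_ge0 ltW.
(* [A3] makes [eps m] smaller than [eps0] up to level [n]; [d0^-1] gives
   [n + 1 <= 1 + d0 * r <= expR (d0 * r)]. *)
have [r0 hr0] := @sqrt_ln_growth R (A2 + A3 + d0^-1) (ltac:(lra)).
exists r0 => r /hr0[r1 Av Au].
have tE := rate_sqrtE s0 D0 r1; rewrite -/D1 tE -/b {tE}.
set v := Num.sqrt (ln r) in Av *.
have Lv : ln r = v ^+ 2 by rewrite sqr_sqrtr// ln_ge0.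
rewrite Lv in Au.
have ru : r = Num.sqrt r ^+ 2 by rewrite sqr_sqrtr//; lra.
have lu : ln (Num.sqrt r) = v ^+ 2 / 2 by rewrite ln_sqrt ?Lv//; lra.
move: (Num.sqrt r) ru lu Au => u ru lu Au.
have v1 : 1 <= v by lra.
have v2 : 1 <= v ^+ 2 by rewrite expr_ge1//; lra.
have uA : A2 + A3 + d0^-1 <= u by apply: le_trans Au; rewrite ler_peMr//; lra.
have u1 : 1 <= u by lra.
have u0 : 0 < u by lra.
have Av2 : A2 <= v by lra.
have /truncn_itv/andP[nu un] := ltW u0.
move: (Num.truncn u) nu un => n nu un.
have mu m : (0 < m <= n)%N -> 1 <= m%:R :> R /\ m%:R <= u.
  move=> /andP[m0 mn]; rewrite ler1n m0; split => //.
  by apply: le_trans nu; rewrite ler_nat.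
have um m : (n < m)%N -> u < m%:R.
  by move=> nm; apply: (lt_le_trans un); rewrite ler_nat.
have pow2E m : expR (- ((1 - dl) * (b * u * v))) / (2 ^ m.+1)%:R =
    expR (- ((1 - dl) * (b * u * v)) - (m%:R + 1) * l2).
  by rewrite expRB natr1 expRM_natl /l2 lnK ?posrE// natrX.
exists n; rewrite -/d0 -/D'; split.
- lra.
- apply: (@le_trans _ _ (expR (d0 * r) * expR ((1 - d0) * r))); last first.
    by rewrite -expRD -mulrDl addrCA subrr addr0 mul1r.
  rewrite ler_wpM2r ?expR_ge0//; apply: le_trans (expR_ge1Dx _).
  rewrite -nat1r lerD2l; apply: (le_trans nu); rewrite ru expr2 mulrA ler_peMl ?(ltW u0)//.
  rewrite -ler_pdivrMl// mulr1; lra.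
- move=> m /[dup] m0n /mu[m1 mle].
  rewrite -[ltRHS]lnK ?posrE// ltr_expR ltrNl.
  apply: (@lt_le_trans _ _ (`|ln eps0| + 1)).
    by rewrite ltr_pwDr// -normrN ler_norm.
  have -> : `|ln eps0| + 1 = A3 * ((1 - d0) / D').
    by rewrite /A3; field; rewrite !gt_eqF.
  have m0' : 0 < m%:R :> R by lra.
  have -> : (1 - d0) * r / (m%:R * D') = r / m%:R * ((1 - d0) / D').
    by field; rewrite !gt_eqF.
  rewrite ler_pM2r ?divr_gt0// ler_pdivlMr// ru expr2.
  by apply: ler_pM => //; lra.
- move=> m /[dup] m0n /mu[m1 mle]; have /andP[m0 _] := m0n.
  rewrite level_weightE//; last by lra.
  rewrite pow2E ler_expR -/l2 -/l4 -/lA.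
  have [_ /(_ mle)] := main u v m%:R Av2 u1 lu m1.
  rewrite -/d0 -/D' ru.
  have lm : ln m%:R <= m%:R :> R by rewrite ltW// ln_sublinear//; lra.
  have := coding_constant l4 s0 m1 lm (ltW l20) l21 lA0; rewrite -/B.
  move: (_ / (m%:R * D')) (ln m%:R) => x l; lra.
- move=> m nm; have ltu := um _ nm; have m1 : 1 <= m%:R :> R by lra.
  have m0 : (0 < m)%N by exact: leq_ltn_trans nm.
  (* Since [2 * expR (- ln 2) = 1], the levels above [n] fit the formula of the lower ones with
     resolution exponent [ln 2]. *)
  have -> : A = (2 * expR (- l2)) `^ s * A.
    by rewrite expRN /l2 lnK ?posrE// divff// powR1 mul1r.
  rewrite level_weightE//; last by lra.
  rewrite pow2E ler_expR -/l2 -/l4 -/lA.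
  have [/(_ ltu) h _] := main u v m%:R Av2 u1 lu m1.
  have lm : ln m%:R <= m%:R :> R by rewrite ltW// ln_sublinear//; lra.
  have := coding_constant l4 s0 m1 lm (ltW l20) l21 lA0; rewrite -/B.
  have := mulr_ge0 (ltW s0) (ltW l20).
  have bu0 : 0 <= dl * (b * u * v) by rewrite !mulr_ge0// ?(ltW b0) ?(ltW u0)//; lra.
  move: h bu0; move: (b * u * v) (ln m%:R) => x l; lra.
Qed.

(** * Upper bound on the error *)

Section upper_rate.
Context {R : realType} {d : nat} {dT : measure_display} {T : measurableType dT}.
Variables (P : probability T R) (lam s : R).
Variables (e : nat -> T -> R) (Z : nat -> T -> d.-tuple R).
Hypotheses (lam0 : 0 < lam) (s0 : 0 < s).
Hypothesis me : forall j, measurable_fun setT (e j).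
Hypothesis law_e : forall j (A : set R), measurable A ->
  P (e j @^-1` A) = exponential_prob 1 A.
Hypothesis mZ : forall i, measurable_fun setT (Z i).
Hypothesis law_Z : forall i (A : set (d.-tuple R)), measurable A ->
  P (Z i @^-1` A) = P (Z 0%N @^-1` A).
Hypothesis ind : indep_eZ P e Z.

Let moment : \bar R :=
  (\int[P]_w ((supdist (Z 0%N w) (nseq_tuple d 0)) `^ s)%:E)%E.

Lemma jump_cost_integral K L (C : 'I_L -> d.-tuple R) :
  (\int[P]_w jump_cost s K C (Z 0%N w) =
   (K%:R^-1 `^ s)%:E * moment + quantization_cost P (Z 0%N) s C)%E.
Proof.
have m1 (k : R) : measurable_fun setT
    (fun w => ((supdist (Z 0%N w) (nseq_tuple d 0) / k) `^ s)%:E).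
  exact: (measurableT_comp (measurable_supdist_powR s (nseq_tuple d 0) k) (mZ 0%N)).
have m2 : measurable_fun setT
    (fun w => \big[Order.min/+oo]_(i < L) poweR (supdist (Z 0%N w) (C i))%:E s)%E.
  exact: (measurableT_comp (measurable_min_cost s C) (mZ 0%N)).
have m3 : measurable_fun setT
    (fun w => ((supdist (Z 0%N w) (nseq_tuple d 0)) `^ s)%:E).
  by have := m1 1; under eq_fun do rewrite divr1.
rewrite /jump_cost ge0_integralD//.
- congr (_ + _)%E; rewrite -ge0_integralZl_EFin ?powR_ge0//.
  + apply: eq_integral => w _.
    by rewrite -EFinM powRM ?supdist_ge0 ?invr_ge0// mulrC.
  + by move=> w _; rewrite lee_fin powR_ge0.
- by move=> w _; rewrite lee_fin powR_ge0.
- by move=> w _; apply: big_mine_ge => i; exact: poweR_ge0.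
Qed.

Hypothesis limsup_dq :
  limf_esup (fun eps : R => lne (dq P (Z 0%N) s eps) * ((ln eps^-1)^-1)%:E)%E
       (0%R)^'+ = (d%:R)%:E.

Lemma moment_fin : exists2 a : R, 0 <= a & moment = a%:E.
Proof.
have [eps0 /andP[eps00 _] hcode] := dq_limsup_codebooks s0 (ler0n R d) ltr01 limsup_dq.
have [L [C [L0 _ cost]]] := hcode (eps0 / 2)
  (ltac:(by apply/andP; split; lra)).
have mo0 : (0 <= moment)%E by apply: integral_ge0 => w _; rewrite lee_fin powR_ge0.
have molt : (moment < +oo)%E.
  by apply: (moment_lty s0 (mZ 0%N) L0); apply: (le_lt_trans cost); rewrite ltry.
exists (fine moment); first exact: fine_ge0.
by rewrite fineK// ge0_fin_numE.
Qed.

Lemma Dq_upper_rate (dl : R) : 0 < dl -> dl < 1 -> exists r0, forall r, r0 <= r ->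
  (Dq P (Xcp lam e Z) (@rhoD R d) (@path_adm R d) s r <=
   (expR (- ((1 - dl) * Num.sqrt (2 / (s * (1 + d%:R)) * r * ln r))))%:E)%E.
Proof.
move=> dl0 dl1; pose d0 := dl / 3; have d00 : 0 < d0 by rewrite divr_gt0.
have [a a0 moE] := moment_fin.
have [eps0 /andP[eps00 eps01] hcode] := dq_limsup_codebooks s0 (ler0n R d) d00 limsup_dq.
(* Dominates both [a + 1], needed at the coded levels, and [a + a], the cost of the zero path at the
   levels above [n]. *)
pose A := 2 * a + 1; have A1 : 1 <= A by rewrite lerDr mulr_ge0.
have [r0 hr0] := coding_terms d s0 lam0 A1 dl0 dl1 eps00.
exists r0 => r /hr0[n [r_ge0 count epslt lowm highm]].
rewrite -/d0 in count epslt lowm.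
set D' := 1 + d%:R + d0 in epslt lowm.
have D'0 : 0 < D' by rewrite addr_gt0// ltr_pwDl.
pose x m : R := (1 - d0) * r / (m%:R * D').
have x0 m : 0 <= x m.
  rewrite divr_ge0 ?mulr_ge0 ?(ltW D'0)//; rewrite /d0; lra.
(* At [m = 0] the division by 0 gives [x 0 = 0] and [eps 0 = 1], so [eps m <= 1] holds at every
   level. *)
pose eps m := expR (- x m).
have epsV m : (eps m)^-1 = expR (x m) by rewrite /eps expRN invrK.
(* Outside [0 < m <= n] only nonemptiness is required, so that codebooks can be chosen for all [m]
   at once. *)
pose good_codebook m (cb : {L : nat & 'I_L -> d.-tuple R}) : Prop :=
  (0 < projT1 cb)%N /\ ((0 < m <= n)%N ->
    (projT1 cb)%:R <= expR ((d%:R + d0) * ln (eps m)^-1) /\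
    (quantization_cost P (Z 0%N) s (projT2 cb) <= ((2 * eps m) `^ s)%:E)%E).
have exists_codebook m : exists cb, good_codebook m cb.
  have [mn|mn] := boolP (0 < m <= n)%N; last first.
    by exists (existT _ 1%N (fun=> nseq_tuple d 0)); split => // h; rewrite h in mn.
  have [L [C [L0 Lle cost]]] := hcode (eps m)
    (introT andP (conj (expR_gt0 _) (epslt m mn))).
  by exists (existT _ L C).
have [cb hcb] := choice exists_codebook.
pose L m := projT1 (cb m); pose C m : 'I_(L m) -> d.-tuple R := projT2 (cb m).
have L0 m : (0 < L m)%N by case: (hcb m).
pose K m := Num.truncn (eps m)^-1.
have eV1 m : 1 <= (eps m)^-1 by rewrite epsV -expR0 ler_expR.
have K0 m : (0 < K m)%N by rewrite truncn_gt0.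
have [Kle leK] : (forall m, (K m)%:R <= (eps m)^-1) /\
    (forall m, (K m)%:R^-1 <= 2 * eps m).
  have it m : (K m)%:R <= (eps m)^-1 < (K m).+1%:R.
    by apply: truncn_itv; apply: le_trans (eV1 m).
  split => m; have /andP[h1 h2] := it m => //.
  have K1 : 1 <= (K m)%:R :> R by rewrite ler1n.
  have e0 : 0 < eps m by exact: expR_gt0.
  rewrite -[leRHS]invrK lef_pV2 ?posrE ?invr_gt0 ?mulr_gt0//; last by lra.
  rewrite invfM; move: h2; rewrite -natr1; lra.
pose I := code_index n K L.
have card_le : (#|{: I}|)%:R <= expR r.
  apply: le_trans count; rewrite card_code_index natr_sum.
  apply: (@le_trans _ _ (\sum_(m < n.+1) expR ((1 - d0) * r))); last first.
    by rewrite sumr_const card_ord -[_ *+ _]mulr_natl.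
  apply: ler_sum => m _; rewrite natrX natrM.
  have [m0|m0] := posnP m.
    rewrite [X in _ ^+ X]m0 expr0 -[leLHS]expR0 ler_expR mulr_ge0//.
    by rewrite /d0; lra.
  have mn : (0 < m <= n)%N by rewrite m0 -ltnS ltn_ord.
  have [_ /(_ mn)[Lle _]] := hcb m.
  have m0' : 0 < m%:R :> R by rewrite ltr0n.
  have -> : expR ((1 - d0) * r) = (expR (x m) * expR ((d%:R + d0) * x m)) ^+ m.
    rewrite -expRD -expRM_natl; congr expR; rewrite /x /D'.
    by field; rewrite !gt_eqF//.
  rewrite lerXn2r ?nnegrE ?mulr_ge0 ?expR_ge0//.
  apply: ler_pM => //; first by rewrite -epsV.
  by apply: (le_trans Lle); rewrite epsV expRK.
have card_gt0 : (1 <= #|{: I}|)%N.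
  by rewrite card_code_index big_ord_recl expn0.
pose cd : 'I_#|{: I}| -> R -> d.-tuple R := codeword (n := n) (K := K) C.
apply: (@le_trans _ _ (poweR (\int[P]_w (\big[Order.min/+oo%E]_(i < #|{: I}|)
    poweR (rhoD (Xcp lam e Z w) (cd i)) s)) s^-1)%E).
  apply: ereal_inf_lbound; exists (existT _ #|{: I}| cd) => //=; split => //; split.
    by move=> i; exact: path_adm_step.
  by rewrite -[leRHS]expRK ler_ln ?posrE ?expR_gt0// ltr0n.
set B := expR (- ((1 - dl) * (s * Num.sqrt (2 / (s * (1 + d%:R)) * r * ln r)))) in lowm highm.
apply: (@le_trans _ _ (poweR B%:E s^-1)); last first.
  rewrite poweR_EFin expR_powR lee_fin ler_expR le_eqVlt; apply/orP; left.
  by apply/eqP; field; rewrite gt_eqF.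
apply: gt0_ler_poweR; first by rewrite invr_ge0 ltW.
- rewrite in_itv/= leey andbT.
  by apply: integral_ge0 => w _; apply: big_mine_ge => i; exact: poweR_ge0.
- by rewrite in_itv/= leey andbT lee_fin expR_ge0.
apply: (le_trans (codebook_integral_le lam0 s0 me law_e mZ law_Z ind n C K0 L0)).
(* Splits [B] into the shares [B / 2 ^ m.+1], against which the levels are compared one by one. *)
apply: le_trans (epsilon_trick0 xpredT (expR_ge0 _)).
have w0 m : 0 <= (2 * m%:R) `^ s * (m%:R * (4 * lam / m%:R) ^+ m) :> R.
  by rewrite mulr_ge0 ?powR_ge0// mulr_ge0// exprn_ge0// divr_ge0// mulr_ge0// ltW.
apply: lee_nneseries => [m _ _|m _].
  by rewrite mule_ge0 ?lee_fin// integral_ge0// => w _; exact: level_cost_ge0.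
have [->|m0] := posnP m.
  rewrite mulr0 powR0 ?gt_eqF// mul0r mul0e lee_fin divr_ge0 ?expR_ge0//.
rewrite /level_cost; pose c : R := (2 * m%:R) `^ s * (m%:R * (4 * lam / m%:R) ^+ m).
case: leqP => mn.
  have m0n : (0 < m <= n)%N by rewrite m0.
  have [_ /(_ m0n)[_ cost]] := hcb m.
  apply: (@le_trans _ _ (c * ((2 * eps m) `^ s * A))%:E); last first.
    by rewrite lee_fin; exact: lowm.
  rewrite [leRHS]EFinM; apply: lee_wpmul2l; first by rewrite lee_fin.
  rewrite jump_cost_integral moE.
  apply: (@le_trans _ _ (((2 * eps m) `^ s * a)%:E + ((2 * eps m) `^ s)%:E)%E).
    apply: leeD => //; rewrite -EFinM lee_fin ler_wpM2r//.
    apply: ge0_ler_powR; rewrite ?nnegrE ?invr_ge0 ?mulr_ge0 ?expR_ge0//.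
    exact: ltW.
  rewrite -EFinD lee_fin -{2}[(2 * eps m) `^ s]mulr1 -mulrDr.
  by rewrite ler_wpM2l ?powR_ge0// /A; lra.
apply: (@le_trans _ _ (c * A)%:E); last by rewrite lee_fin; exact: highm.
rewrite [leRHS]EFinM; apply: lee_wpmul2l; first by rewrite lee_fin.
rewrite jump_cost_integral moE invr1 powR1 mul1e.
have -> : quantization_cost P (Z 0%N) s (fun _ : 'I_1 => nseq_tuple d 0) = a%:E.
  by rewrite -moE; apply: eq_integral => w _; rewrite big_ord1 poweR_EFin.
by rewrite -EFinD lee_fin /A; lra.
Qed.

End upper_rate.

(** * Limit of the rate ratio *)

Lemma rate_gt0 {R : realType} (s : R) (d : nat) (r : R) : 0 < s -> 1 < r ->
  0 < Num.sqrt (2 / (s * (1 + d%:R)) * r * ln r).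
Proof.
move=> s0 r1; rewrite sqrtr_gt0 mulr_gt0 ?ln_gt0// mulr_gt0//; last by lra.
by rewrite divr_gt0// mulr_gt0// ltr_pwDl.
Qed.

Lemma cvge1_pinfty {R : realType} (f : R -> \bar R) :
  (forall dl : R, 0 < dl -> exists r0, forall r, r0 < r -> (f r <= (1 + dl)%:E)%E) ->
  (forall dl : R, 0 < dl -> dl < 1 ->
    exists r0, forall r, r0 < r -> ((1 - dl)%:E <= f r)%E) ->
  f @ pinfty_nbhs R --> 1%E.
Proof.
move=> hup hlow A /= nA; have {nA} nA : nbhs (1 : R) (fun x => A x%:E) := nA.
have /nbhs_ballP[dl /= dl0 HA] := nA.
pose c := Num.min (dl / 2) 2^-1.
have c0 : 0 < c by rewrite lt_min divr_gt0// invr_gt0 ltr0n.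
have c1 : c < 1 by rewrite gt_min invf_lt1// ltr1n orbT.
have cdl : c < dl by rewrite gt_min; apply/orP; left; lra.
have [r1 h1] := hup c c0; have [r2 h2] := hlow c c0 c1.
exists (Num.max r1 r2); split; first exact: num_real.
move=> r; rewrite gt_max => /andP[/h1 hu /h2 hl].
have fin : f r \is a fin_num.
  by rewrite fin_numElt (lt_le_trans (ltNyr _) hl) (le_lt_trans hu (ltry _)).
rewrite /= -(fineK fin); apply: HA.
rewrite -(fineK fin) !lee_fin in hu hl.
by rewrite /ball/= ltr_norml; apply/andP; split; lra.
Qed.

Unset Implicit Arguments.

Theorem theorem6 (R : realType) (d : nat) (dT : measure_display)
  (T : measurableType dT) (P : probability T R) (lam s : R)
  (e : nat -> T -> R) (Z : nat -> T -> d.-tuple R) :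
  (0 < d)%N -> 0 < lam -> 0 < s ->
  (forall j, measurable_fun setT (e j)) ->
  (forall j (A : set R), measurable A -> P (e j @^-1` A) = exponential_prob 1 A) ->
  (forall i, measurable_fun setT (Z i)) ->
  (forall i (A : set (d.-tuple R)), measurable A ->
     P (Z i @^-1` A) = P (Z 0%N @^-1` A)) ->
  indep_eZ P e Z ->
  P (Z 0%N @^-1` [set nseq_tuple d 0]) = 0%E ->
  (exists nu : {measure set (d.-tuple R) -> \bar R},
     (0 < nu setT)%E /\
     (forall A, measurable A -> (nu A <= P (Z 0%N @^-1` A))%E) /\
     (forall A, measurable A -> lebesgue_d A = 0%E -> nu A = 0%E)) ->
  let f := fun r : R =>
    (- lne (Dq P (Xcp lam e Z) (@rhoD R d) (@path_adm R d) s r)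
       * ((Num.sqrt (2 / (s * (1 + d%:R)) * r * ln r))^-1)%:E)%E in
  (limf_esup f (pinfty_nbhs R) <= 1%E)%E /\
  (limf_esup (fun eps : R => lne (dq P (Z 0%N) s eps) * ((ln eps^-1)^-1)%:E)%E
       (0%R)^'+ = (d%:R)%:E ->
   f @ pinfty_nbhs R --> 1%E).
Proof.
move=> d0 lam0 s0 me law_e mZ law_Z ind Z0 [nu [nu0 [nuP nuac]]] f.
(* A lower bound on the error bounds [f] from above; [r > 1] keeps the denominator positive. *)
have upper (dl : R) : 0 < dl -> exists r0, forall r, r0 < r -> (f r <= (1 + dl)%:E)%E.
  move=> dl0.
  have [r0 hr0] := Dq_lower_rate lam0 s0 me law_e mZ law_Z ind Z0 nu0 nuP nuac dl0.
  exists (Num.max r0 1) => r; rewrite gt_max => /andP[/ltW/hr0 h r1].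
  rewrite /f lee_pdivrMr ?rate_gt0// -EFinM.
  exact: neg_lne_le.
split.
  apply: limf_esup_le => dl /upper[r0 h]; exists r0; split; first exact: num_real.
  exact: h.
move=> limsup_dq; apply: cvge1_pinfty => // dl dl0 dl1.
have [r0 hr0] := Dq_upper_rate lam0 s0 me law_e mZ law_Z ind limsup_dq dl0 dl1.
exists (Num.max r0 1) => r; rewrite gt_max => /andP[/ltW/hr0 h r1].
rewrite /f lee_pdivlMr ?rate_gt0// -EFinM; apply: neg_lne_ge => //.
by apply: le_ereal_inf_tmp => _ [nC _ <-]; exact: poweR_ge0.
Qed.
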